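(* Let $S$ be a finite generating subset of an abelian group $G$ of order at least $2$. Let $T$ be a finite subset of $G$ such that $|S|\le |T|$, $S+T$ is aperiodic, $0\in S\cap T$, and $$\frac{2|G|+2}{3}\ge |S+T|=|S|+|T|-1.$$ Let $H$ be a hyper-atom of $S$ and let $\phi:G\to G/H$ be the canonical morphism. Then $S$ and $T$ are $H$-quasi-periodic, and $\phi(S)$ and $\phi(T)$ are arithmetic progressions with the same difference.
   Context: The period of $A\subseteq G$ is $\Pi(A)=\{x: A+x=A\}$; $A$ is aperiodic if $\Pi(A)=\{0\}$. For a subgroup $H$, $A$ is $H$-quasi-periodic if there exists $x\in G$ with $(A\setminus(x+H))+H=A\setminus(x+H)$. For $X\subseteq G$, $X^S=G\setminus(X+S)$. $\kappa_1(S)=\min\{|X+S|-|X|: X\text{ finite}, |X|\ge1, |X+S|\le|G|-1\}$ (minimum of the empty set taken as $|G|-1$). A $1$-fragment of $S$ is a finite $X$ with $|X|\ge1$, $|X^S|\ge1$, $|X+S|-|X|=\kappa_1(S)$. A hyper-atom of $S$ is a subgroup of $G$ of maximal cardinality among subgroups that are $1$-fragments of $S$. An arithmetic progression with difference $d$ is a set $\{a,a+d,\dots,a+jd\}$. *)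

(* Defs.v *)
From mathcomp Require Import all_boot all_order all_algebra.
From mathcomp Require Import finmap all_classical constructive_ereal.

Set Implicit Arguments.
Unset Strict Implicit.
Unset Printing Implicit Defensive.

Import Order.TTheory GRing.Theory Num.Theory.

Local Open Scope classical_set_scope.
Local Open Scope ring_scope.

(* The group G is a zmodType, possibly infinite, and its subsets are classical
   sets. A subgroup of G is an H : zmodClosed G, and [set` H] is its underlying
   set: classically every additive subgroup is given by a boolean predicate.
   The canonical morphism G -> G / H is \pi_(Quotient.quot H). *)

(* Every infinite set has cardinality +oo, so that order conditions on G such
   as |X + S| <= |G| - 1 hold for all finite sets when G is infinite. *)
Definition ecard (T : choiceType) (A : set T) : \bar int :=
  if `[< finite_set A >] then (#|` fset_set A |%:Z)%:E%E else +oo%E.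

Section Definitions.
Variable G : zmodType.
Implicit Types (A B S X : set G) (x : G) (H : zmodClosed G).

Definition sumset A B : set G := [set a + b | a in A & b in B].

Definition generating S : Prop :=
  smallest (fun A : set G => exists H, A = [set` H]) S = [set: G].

Definition period A : set G := [set x | sumset A [set x] = A].

Definition aperiodic A : Prop := period A = [set 0].

Definition quasi_periodic H A : Prop :=
  exists x, sumset (A `\` sumset [set x] [set` H]) [set` H]
            = A `\` sumset [set x] [set` H].

(* X^S in the literature. *)
Definition sdual S X : set G := ~` sumset X S.

(* The numbers |X + S| - |X| whose minimum is kappa_1(S). *)
Definition kappa1_range S : set (\bar int) :=
  [set (ecard (sumset X S) - ecard X)%E | X in
     [set X | [/\ finite_set X, (1 <= ecard X)%E
                & (ecard (sumset X S) <= ecard [set: G] - 1)%E]]].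

(* The default value of xget is the convention for the minimum of the empty
   set. When S is finite and nonempty, kappa1_range S is a set of natural
   numbers, so the default is used only if that set is empty. *)
Definition kappa1 S : \bar int :=
  xget (ecard [set: G] - 1)%E
    [set k | kappa1_range S k /\ forall l, kappa1_range S l -> (k <= l)%E].

Definition fragment1 S X : Prop :=
  [/\ finite_set X, (1 <= ecard X)%E, (1 <= ecard (sdual S X))%E
    & (ecard (sumset X S) - ecard X)%E = kappa1 S].

Definition hyper_atom S H : Prop :=
  fragment1 S [set` H] /\
  forall K : zmodClosed G,
    fragment1 S [set` K] -> (ecard [set` K] <= ecard [set` H])%E.

Definition arith_prog (d : G) A : Prop :=
  exists (a : G) (j : nat), A = [set a + d *+ i | i in [set i | (i <= j)%N]].

End Definitions.

(* Main.v *)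
Require Import Defs.
From HB Require Import structures.
From mathcomp Require Import all_boot all_order all_algebra.
From mathcomp Require Import finmap all_classical constructive_ereal.
From mathcomp Require Import zify.

Set Implicit Arguments.
Unset Strict Implicit.
Unset Printing Implicit Defensive.

Import GRing.Theory.

(* Kneser's theorem (in DeVos's form) drives the proof. Let Q = G / H, A and B
   the images of S and T in Q. Since H is a 1-fragment of S, S misses fewer than
   |H| elements of S + H; since H is a maximal subgroup among the 1-fragments,
   |A + K| >= |A| + |K| for all proper nontrivial finite subgroups K of Q, and
   Kneser's theorem then gives |X + A| >= |X| + |A| - 1 whenever X + A <> Q.

   Counting S + T by the level sets of the sizes of its H-components gives
   |A + B| = |A| + |B| - 1 < |Q|, and shows that all components of S + T but one
   are full and that this one, S_i + T_j, arises from only one pair (i, j).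
   Filling up the other components of S and T does not change S + T, which is
   aperiodic, so by Kneser's theorem they were full: S and T are quasi-periodic.

   If |A| > 2, A + B misses two elements of Q, so that B is a 2-fragment of A.
   A 2-fragment M of A of minimal size meets its nontrivial translates in at most
   one point. If |M| > 2, then M has itself such a minimal 2-fragment N, which is
   impossible because two such sets satisfy |M + N| >= 3 max(|M|, |N|) - 3. Hence
   |M| = 2, so A is an arithmetic progression, and then so is B. *)

(** * Sumsets and finite subgroups *)

Local Open Scope fset_scope.

Definition addfs (V : zmodType) (A B : {fset V}) : {fset V} :=
  [fset (a + b)%R | a in A, b in B].

Notation "A :+: B" := (addfs A B) (at level 45, left associativity) : fset_scope.

Definition fgroup (V : zmodType) (K : {fset V}) : Prop :=
  (0%R \in K) /\ {in K &, forall x y, (x - y)%R \in K}.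

(** A period of a nonempty [A] is a difference of two of its elements, so filtering the differences
    gives the whole period as a finite set. *)
Definition stab (V : zmodType) (A : {fset V}) : {fset V} :=
  [fset x in [fset (a - b)%R | a in A, b in A] | A :+: [fset x] == A].

(** Keeps only the facts on natural numbers and turns every cardinal into a variable before calling
    [lia]. *)
Ltac card_lia :=
  repeat match goal with
  | H : ?T |- _ => lazymatch T with
    | is_true (leq _ _) => revert H
    | @eq nat _ _ => revert H
    end
  end;
  repeat match goal with |- context [size (enum_fset ?X)] =>
    let n := fresh "n" in move: (size (enum_fset X)) => n end;
  clear; lia.

Section SumSets.
Variable V : zmodType.
Implicit Types (A B C D K : {fset V}) (x y z : V).

Lemma addfsP A B x :
  reflect (exists2 a, a \in A & exists2 b, b \in B & x = (a + b)%R)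
          (x \in A :+: B).
Proof. exact: imfset2P. Qed.

Lemma mem_addfs A B x y : x \in A -> y \in B -> (x + y)%R \in A :+: B.
Proof. by move=> xA yB; apply/addfsP; exists x => //; exists y. Qed.

Lemma addfsC A B : A :+: B = B :+: A.
Proof.
by apply/fsetP=> x; apply/addfsP/addfsP=> -[a aA [b bB ->]];
  exists b => //; exists a => //; rewrite addrC.
Qed.

Lemma addfsA A B C : A :+: (B :+: C) = A :+: B :+: C.
Proof.
apply/fsetP=> x; apply/addfsP/addfsP.
  move=> [a aA [_ /addfsP[b bB [c cC ->]] ->]].
  by exists (a + b)%R; [exact: mem_addfs | exists c => //; rewrite addrA].
move=> [_ /addfsP[a aA [b bB ->]] [c cC ->]].
by exists a => //; exists (b + c)%R; [exact: mem_addfs | rewrite addrA].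
Qed.

Lemma addfsAC A B C : A :+: B :+: C = A :+: C :+: B.
Proof. by rewrite -!addfsA (addfsC B). Qed.

Lemma mem_addfs1 A x y : (y \in A :+: [fset x]) = ((y - x)%R \in A).
Proof.
apply/addfsP/idP=> [[a aA [b /fset1P -> ->]]|yA]; first by rewrite addrK.
by exists (y - x)%R => //; exists x; rewrite ?inE // subrK.
Qed.

Lemma addfs0 A : A :+: [fset 0%R] = A.
Proof. by apply/fsetP=> x; rewrite mem_addfs1 subr0. Qed.

Lemma addfs11 x y : [fset x] :+: [fset y] = [fset (x + y)%R].
Proof. by apply/fsetP=> z; rewrite mem_addfs1 !inE subr_eq. Qed.

Lemma card_addfs1 A x : #|` A :+: [fset x]| = #|` A|.
Proof.
suff -> : A :+: [fset x] = [fset (a + x)%R | a in A].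
  by rewrite card_imfset //; exact: addIr.
apply/fsetP=> y; apply/addfsP/imfsetP => [[a aA [b /fset1P -> ->]]|[a aA ->]].
  by exists a.
by exists a => //; exists x; rewrite ?inE.
Qed.

Lemma addfsS A B C D : A `<=` B -> C `<=` D -> A :+: C `<=` B :+: D.
Proof.
move=> /fsubsetP AB /fsubsetP CD; apply/fsubsetP=> _ /addfsP[a aA [c cC ->]].
by apply: mem_addfs; [exact: AB | exact: CD].
Qed.

Lemma addfsUl A B C : (A `|` B) :+: C = (A :+: C) `|` (B :+: C).
Proof.
apply/eqP; rewrite eqEfsubset fsubUset !addfsS ?fsubsetUl ?fsubsetUr // !andbT.
apply/fsubsetP=> _ /addfsP[a + [c cC ->]]; rewrite !inE.
by case/orP=> aAB; apply/orP; [left|right]; exact: mem_addfs.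
Qed.

Lemma addfs_neq0 A B : (A :+: B != fset0) = (A != fset0) && (B != fset0).
Proof.
apply/fset0Pn/andP => [[_ /addfsP[a aA [b bB _]]]|].
  by split; apply/fset0Pn; [exists a | exists b].
by case=> /fset0Pn[a aA] /fset0Pn[b bB]; exists (a + b)%R; exact: mem_addfs.
Qed.

Lemma leq_card_addfs A B : B != fset0 -> #|` A| <= #|` A :+: B|.
Proof.
move=> /fset0Pn[b bB]; rewrite -(card_addfs1 A b).
by apply: fsubset_leq_card; apply: addfsS; rewrite ?fsub1set.
Qed.

Lemma addfs_stable A x : A :+: [fset x] `<=` A -> A :+: [fset x] = A.
Proof. by move=> sA; apply/eqP; rewrite eqEfcard sA card_addfs1 leqnn. Qed.

Lemma fgroupN K x : fgroup K -> x \in K -> (- x)%R \in K.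
Proof. by case=> K0 KB xK; rewrite -sub0r KB. Qed.

Lemma fgroupD K x y : fgroup K -> x \in K -> y \in K -> (x + y)%R \in K.
Proof. by move=> gK xK yK; rewrite -[y]opprK; apply: gK.2 => //; exact: fgroupN. Qed.

Lemma fgroup_neq0 K : fgroup K -> K != fset0.
Proof. by case=> K0 _; apply/fset0Pn; exists 0%R. Qed.

Lemma fgroup_gt0 K : fgroup K -> 0 < #|` K|.
Proof. by move=> gK; rewrite cardfs_gt0 fgroup_neq0. Qed.

Lemma sub_addfs_fgroup A K : fgroup K -> A `<=` A :+: K.
Proof. by case=> K0 _; apply/fsubsetP=> a aA; rewrite -[a]addr0 mem_addfs. Qed.

Lemma fgroup_addfs K : fgroup K -> K :+: K = K.
Proof.
move=> gK; apply/eqP; rewrite eqEfsubset sub_addfs_fgroup // andbT.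
by apply/fsubsetP=> _ /addfsP[a aK [b bK ->]]; exact: fgroupD.
Qed.

Lemma addfs_fgroup_sub A K J :
  fgroup J -> J `<=` K -> A :+: K = A -> A :+: J = A.
Proof.
move=> gJ JK AK; apply/eqP; rewrite eqEfsubset sub_addfs_fgroup // andbT.
by rewrite -{2}AK addfsS.
Qed.

Lemma mem_coset K x y : (y \in [fset x] :+: K) = ((y - x)%R \in K).
Proof. by rewrite addfsC mem_addfs1. Qed.

Lemma card_coset K x : #|` [fset x] :+: K| = #|` K|.
Proof. by rewrite addfsC card_addfs1. Qed.

Lemma coset_id K x : fgroup K -> x \in [fset x] :+: K.
Proof. by case=> K0 _; rewrite mem_coset subrr. Qed.

Lemma coset_eq K x y :
  fgroup K -> (x - y)%R \in K -> [fset x] :+: K = [fset y] :+: K.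
Proof.
move=> gK xyK; apply/fsetP=> z; rewrite !mem_coset.
apply/idP/idP=> zK; first by rewrite -[z](subrK x) -addrA fgroupD.
by rewrite -[z](subrK y) -addrA fgroupD // -opprB fgroupN.
Qed.

Lemma coset_disjoint K x y :
  fgroup K -> (x - y)%R \notin K -> [disjoint [fset x] :+: K & [fset y] :+: K].
Proof.
move=> gK xyK; apply/fdisjointP=> z; rewrite !mem_coset => zx.
apply: contra xyK => zy.
by have := gK.2 _ _ zy zx; rewrite opprB addrC addrA subrK.
Qed.

Lemma mem_stab A x : A != fset0 -> (x \in stab A) = (A :+: [fset x] == A).
Proof.
move=> /fset0Pn[a aA]; rewrite !inE andbC.
case: eqP => //= AxA; apply/imfset2P; exists (a + x)%R.
  by rewrite /= -AxA mem_addfs1 addrK.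
by exists a => //; rewrite addrC addrA addNr add0r.
Qed.

Lemma stabP A : A != fset0 -> A :+: stab A = A.
Proof.
move=> A0; apply/eqP; rewrite eqEfsubset; apply/andP; split; apply/fsubsetP=> y.
  case/addfsP=> a aA [x]; rewrite mem_stab // => /eqP AxA ->.
  by rewrite -AxA mem_addfs ?inE.
by move=> yA; rewrite -[y]addr0 mem_addfs // mem_stab // addfs0.
Qed.

Lemma fgroup_stab A : A != fset0 -> fgroup (stab A).
Proof.
move=> A0; split; first by rewrite mem_stab // addfs0.
move=> x y; rewrite !mem_stab // => /eqP Ax /eqP Ay; apply/eqP.
by rewrite -addfs11 addfsA Ax -{1}Ay -addfsA addfs11 subrr addfs0.
Qed.

Lemma sub_stab A K : A != fset0 -> A :+: K = A -> K `<=` stab A.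
Proof.
move=> A0 AK; apply/fsubsetP=> x xK; rewrite mem_stab //; apply/eqP.
by apply: addfs_stable; rewrite -{2}AK addfsS // fsub1set.
Qed.

Lemma stab_sub_coset A K x :
  fgroup K -> A != fset0 -> A `<=` [fset x] :+: K -> stab A `<=` K.
Proof.
move=> gK /[dup] A0 /fset0Pn[a aA] /fsubsetP AK; apply/fsubsetP=> y.
rewrite mem_stab // => /eqP AyA.
have ayA : (a + y)%R \in A by rewrite -AyA mem_addfs ?inE.
move: (AK _ ayA) (AK _ aA); rewrite !mem_coset => h1 h2.
by have := gK.2 _ _ h1 h2; rewrite opprB addrA subrK [(a + y)%R]addrC addrK.
Qed.

End SumSets.

Global Opaque addfs stab.

(** * Kneser's theorem *)

Section Kneser.
Variable V : zmodType.
Implicit Types (A B C D U K H J : {fset V}) (x y z : V).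

Lemma cardfsU_le A B : #|` A `|` B| <= #|` A| + #|` B|.
Proof. by rewrite cardfsU leq_subr. Qed.

Lemma mem_coset_addfs A K x y :
  x \in A -> y \in [fset x] :+: K -> y \in A :+: K.
Proof. by move=> xA; apply/fsubsetP/addfsS; rewrite ?fsub1set. Qed.

Local Notation weak A B := (#|` A| + #|` B| <= #|` A :+: B| + #|` stab (A :+: B)|).

(** A point of x + H in (A ∪ B) + J is v + j with v in A or B, and v stays in x + H since J lies in
    H. Counting bounds |H| by the parts of A and B in that coset. *)
Lemma coset_addfs_split A B H J x :
  fgroup H -> fgroup J -> J `<=` H -> x \in A `|` B ->
  [fset x] :+: H `<=` (((A `|` B) :+: H) `\` ((A `|` B) :+: J))
    `|` (((A `&` ([fset x] :+: H)) :+: J) `|` ((B `&` ([fset x] :+: H)) :+: J)).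
Proof.
move=> gH gJ /fsubsetP JH xU.
apply/fsubsetP=> u; rewrite !in_fsetU in_fsetD.
have [uJ uH|_ /= uH] := boolP (u \in (A `|` B) :+: J); last first.
  by rewrite -{1}[u](subrK x) addrC mem_addfs // -(mem_coset H).
case/addfsP: uJ uH => v vU [j jJ ->] uH.
have vH : v \in [fset x] :+: H.
  by have := gH.2 _ _ _ (JH _ jJ); move: uH; rewrite !mem_coset => h /(_ _ h);
     rewrite addrAC addrK.
rewrite /=; case/fsetUP: vU => vU; apply/orP; [left|right]; apply: mem_addfs=> //.
all: by rewrite in_fsetI vU vH.
Qed.

(** DeVos's refinement of a convergent. Passing from (C, H) to (C ∪ D, J), the last inequality
    preserves |A ∩ B| + |(A ∪ B) + H| <= |C| + |H|, while the subgroup shrinks. *)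
Lemma kneser_step A B C H a b z :
  fgroup H -> C != fset0 -> C `<=` A :+: B -> C :+: H = C ->
  (forall A' B', A' != fset0 -> B' != fset0 ->
     #|` A' :+: B'| < #|` A :+: B| -> weak A' B') ->
  a \in A -> b \in B -> z \in [fset (a + b)%R] :+: H -> z \notin A :+: B ->
  exists D J, [/\ fgroup J, J `<=` H & #|` J| < #|` H|] /\
    [/\ D `<=` A :+: B, C `&` D = fset0, D :+: J = D &
    #|` (A `|` B) :+: J| + #|` H| <= #|` (A `|` B) :+: H| + #|` D| + #|` J|].
Proof.
move=> gH C0 CAB CH IH aA bB zT zAB.
pose ca := [fset a] :+: H; pose cb := [fset b] :+: H.
pose T := [fset (a + b)%R] :+: H; rewrite -/T in zT.
have caT : ca :+: cb = T.
  by rewrite /ca /cb addfsA (addfsAC _ _ [fset b]) addfs11 -addfsA fgroup_addfs.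
pose A1 := A `&` ca; pose B1 := B `&` cb; pose A2 := A `&` cb; pose B2 := B `&` ca.
pose D := (A1 :+: B1) `|` (A2 :+: B2); pose J := stab D.
have D1T : A1 :+: B1 `<=` T by rewrite -caT addfsS ?fsubsetIr.
have D2T : A2 :+: B2 `<=` T by rewrite -caT addfsC addfsS ?fsubsetIr.
have DT : D `<=` T by rewrite fsubUset D1T.
have DAB : D `<=` A :+: B by rewrite fsubUset !addfsS ?fsubsetIl.
have a1 : a \in A1 by rewrite in_fsetI aA coset_id.
have b1 : b \in B1 by rewrite in_fsetI bB coset_id.
have D0 : D != fset0.
  by apply/fset0Pn; exists (a + b)%R; rewrite in_fsetU mem_addfs.
have gJ : fgroup J := fgroup_stab D0.
have JH : J `<=` H := stab_sub_coset gH D0 DT.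
have DJ : D :+: J = D := stabP D0.
have zD : z \notin D by apply: contra zAB; apply: (fsubsetP DAB).
have cosetT y : y \in T -> [fset y] :+: H = T.
  by rewrite mem_coset => yT; apply: coset_eq.
(* If J were H, then D would fill the coset T and contain z. *)
have JltH : #|` J| < #|` H|.
  rewrite ltn_neqAle fsubset_leq_card // andbT; apply: contra zD => /eqP eJH.
  have eJ : J = H by apply/eqP; rewrite eqEfcard JH eJH leqnn.
  have /fset0Pn[y yD] := D0.
  by rewrite -DJ eJ (mem_coset_addfs yD) // (cosetT _ (fsubsetP DT _ yD)).
(* A point of C in T would put all of T, hence z, into C. *)
have CD : C `&` D = fset0.
  apply/eqP/fdisjointP=> y yC; apply: contra zAB => yD.
  apply: (fsubsetP CAB); rewrite -CH.
  by rewrite (mem_coset_addfs yC) // (cosetT _ (fsubsetP DT _ yD)).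
have cardD X : X `<=` D -> #|` X| < #|` A :+: B|.
  move=> XD; apply: (@leq_trans (#|` C| + #|` D|)).
    by rewrite -add1n leq_add ?fsubset_leq_card // cardfs_gt0.
  have := cardfsUI C D; rewrite CD cardfs0 addn0 => <-.
  by rewrite fsubset_leq_card // fsubUset CAB.
(* The induction hypothesis for the pair (X + J, Y + J). *)
have IHJ X Y : X != fset0 -> Y != fset0 -> X :+: Y `<=` D ->
    let E := X :+: Y :+: J in
    [/\ #|` X :+: J| + #|` Y :+: J| <= #|` E| + #|` stab E|,
        E != fset0, E `<=` D, J `<=` stab E & stab E `<=` H].
  move=> X0 Y0 XYD E.
  have J0 := fgroup_neq0 gJ.
  have E0 : E != fset0 by rewrite !addfs_neq0 X0 Y0.
  have ED : E `<=` D by rewrite -DJ addfsS.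
  have EE : (X :+: J) :+: (Y :+: J) = E.
    by rewrite addfsA (addfsAC X J) -addfsA fgroup_addfs.
  split=> //.
  - have := IH (X :+: J) (Y :+: J); rewrite EE; apply.
    + by rewrite addfs_neq0 X0.
    + by rewrite addfs_neq0 Y0.
    + exact: cardD.
  - by apply: sub_stab => //; rewrite -addfsA fgroup_addfs.
  - exact: (stab_sub_coset gH E0 (fsubset_trans ED DT)).
exists D, J; split=> //; split=> //.
have UJH : (A `|` B) :+: J `<=` (A `|` B) :+: H by rewrite addfsS.
have cardUD : (#|` ((A `|` B) :+: H) `\` ((A `|` B) :+: J)| + #|` (A `|` B) :+: J|
    = #|` (A `|` B) :+: H|)%N.
  by rewrite cardfsDS // subnK // fsubset_leq_card.
have splita : ca `<=` (((A `|` B) :+: H) `\` ((A `|` B) :+: J))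
    `|` ((A1 :+: J) `|` (B2 :+: J)).
  by apply: coset_addfs_split => //; rewrite in_fsetU aA.
have splitb : cb `<=` (((A `|` B) :+: H) `\` ((A `|` B) :+: J))
    `|` ((A2 :+: J) `|` (B1 :+: J)).
  by apply: coset_addfs_split => //; rewrite in_fsetU bB orbT.
have A10 : A1 != fset0 by apply/fset0Pn; exists a.
have B10 : B1 != fset0 by apply/fset0Pn; exists b.
(* If a + H = b + H, only one coset is counted; otherwise both a + H and b + H are, which gives
   [two]. *)
have [abH|abH] := boolP ((a - b)%R \in H).
  have cab : ca = cb by apply: coset_eq.
  have DD : D = A1 :+: B1 by rewrite /D /A2 /B2 -cab -/A1 cab -/B1 fsetUid.
  have [|+ _ _ _ _] := IHJ _ _ A10 B10 _; first by rewrite DD.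
  rewrite -DD DJ -/J.
  have := fsubset_leq_card splita; rewrite card_coset.
  have := cardfsU_le (((A `|` B) :+: H) `\` ((A `|` B) :+: J)) ((A1 :+: J) `|` (B2 :+: J)).
  have := cardfsU_le (A1 :+: J) (B2 :+: J).
  have -> : B2 = B1 by rewrite /B2 /B1 cab.
  card_lia.
have /eqP Dab : ca `&` cb == fset0 by apply: coset_disjoint.
have two : #|` H| + #|` H| + #|` (A `|` B) :+: J| <= #|` (A `|` B) :+: H| +
    (#|` A1 :+: J| + #|` B1 :+: J|) + (#|` A2 :+: J| + #|` B2 :+: J|).
  have := cardfsUI ca cb; rewrite Dab cardfs0 addn0 !card_coset => cU.
  have : ca `|` cb `<=` (((A `|` B) :+: H) `\` ((A `|` B) :+: J)) `|`
     (((A1 :+: J) `|` (B2 :+: J)) `|` ((A2 :+: J) `|` (B1 :+: J))).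
    rewrite fsubUset (fsubset_trans splita) ?(fsubset_trans splitb) //.
      by rewrite fsetUS // fsubsetUr.
    by rewrite fsetUS // fsubsetUl.
  move/fsubset_leq_card.
  have := cardfsU_le (((A `|` B) :+: H) `\` ((A `|` B) :+: J))
     (((A1 :+: J) `|` (B2 :+: J)) `|` ((A2 :+: J) `|` (B1 :+: J))).
  have := cardfsU_le ((A1 :+: J) `|` (B2 :+: J)) ((A2 :+: J) `|` (B1 :+: J)).
  have := cardfsU_le (A1 :+: J) (B2 :+: J).
  have := cardfsU_le (A2 :+: J) (B1 :+: J).
  card_lia.
have E1D : A1 :+: B1 `<=` D by exact: fsubsetUl.
have E2D : A2 :+: B2 `<=` D by exact: fsubsetUr.
have leH X x : X `<=` [fset x] :+: H -> #|` X :+: J| <= #|` H|.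
  move=> XH; rewrite -(card_coset H x) fsubset_leq_card //.
  have -> : [fset x] :+: H = [fset x] :+: H :+: H by rewrite -addfsA fgroup_addfs.
  exact: addfsS.
have [h1 E10 _ J1 H1] := IHJ _ _ A10 B10 E1D.
(* If one of A2, B2 is empty, its term in [two] vanishes and the other one is at most |H|. *)
have [e20|] := boolP ((A2 == fset0) || (B2 == fset0)).
  have D2 : A2 :+: B2 = fset0.
    by apply/eqP; rewrite -[_ == _]negbK addfs_neq0 negb_and !negbK.
  have DD : D = A1 :+: B1 by rewrite /D D2 fsetU0.
  move: h1; rewrite -DD DJ -/J.
  have addfs0s X : X == fset0 -> #|` X :+: J| = 0.
    move=> X0; apply/eqP; rewrite cardfs_eq0 -[_ == _]negbK addfs_neq0 negb_and.
    by rewrite negbK X0.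
  case/orP: e20 => /addfs0s e0.
    by have := leH _ _ (fsubsetIr B ca : B2 `<=` ca); card_lia.
  by have := leH _ _ (fsubsetIr A cb : A2 `<=` cb); card_lia.
rewrite negb_or => /andP[A20 B20].
have [h2 E20 _ J2 H2] := IHJ _ _ A20 B20 E2D.
set E1 := A1 :+: B1 :+: J in h1 E10 J1 H1; set E2 := A2 :+: B2 :+: J in h2 E20 J2 H2.
have EU : E1 `|` E2 = D by rewrite -addfsUl DJ.
have eJ : J = stab D by [].
clearbody E1 E2 J D; clear - D0 eJ h1 h2 two E10 E20 J1 J2 H1 H2 EU zD zT DT cosetT.
(* An element of both stabilizers stabilizes D = E1 ∪ E2, hence lies in J. As z is outside D, X is
   disjoint from E1 ∩ E2, and both fit into the coset T, which has |H| elements. *)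
pose X := ([fset z] :+: stab E1) `|` ([fset z] :+: stab E2).
have cX : #|` stab E1| + #|` stab E2| <= #|` X| + #|` J|.
  have := cardfsUI ([fset z] :+: stab E1) ([fset z] :+: stab E2).
  rewrite !card_coset -/X => <-; rewrite leq_add2l.
  rewrite -(card_coset J z); apply: fsubset_leq_card; apply/fsubsetP=> y.
  rewrite eJ in_fsetI !mem_coset !mem_stab // => /andP[/eqP e1 /eqP e2].
  by rewrite -EU addfsUl e1 e2.
have cXE : #|` X| + #|` E1 `&` E2| <= #|` H|.
  have XE : X `&` (E1 `&` E2) = fset0.
    apply/eqP; apply/fdisjointP=> y.
    have aux E : E != fset0 -> E `<=` D -> y \in [fset z] :+: stab E -> y \in E ->
        False.
      move=> E0 ED; rewrite mem_coset => yz yE; move/negP: zD; apply.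
      apply: (fsubsetP ED); rewrite -(stabP E0).
      have -> : z = (y + - (y - z))%R by rewrite opprB addrC subrK.
      by rewrite mem_addfs // fgroupN // ; apply: fgroup_stab.
    rewrite in_fsetU => /orP[] yz; apply/negP; rewrite in_fsetI => /andP[y1 y2].
      by apply: (aux E1); rewrite // -EU fsubsetUl.
    by apply: (aux E2); rewrite // -EU fsubsetUr.
  have := cardfsUI X (E1 `&` E2); rewrite XE cardfs0 addn0 => <-.
  rewrite -(card_coset H z) fsubset_leq_card // !fsubUset !addfsS //= (cosetT z) //.
  apply: fsubset_trans DT.
  by rewrite -EU (fsubset_trans (fsubsetIl _ _)) ?fsubsetUl.
have := cardfsUI E1 E2; rewrite EU; card_lia.
Qed.

(** Induction on |A + B|, then on |A|. *)
Lemma kneser_weak A B : A != fset0 -> B != fset0 ->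
  #|` A| + #|` B| <= #|` A :+: B| + #|` stab (A :+: B)|.
Proof.
have [n] := ubnP #|` A :+: B|; elim: n A B => // n IHn A B.
have [m] := ubnP #|` A|; elim: m A B => // m IHm A B; rewrite !ltnS.
move=> Am ABn A0 B0.
have trB x : stab (A :+: (B :+: [fset x])) = stab (A :+: B).
  apply/fsetP=> y; rewrite !mem_stab ?addfs_neq0 ?A0 ?B0 //; last first.
    by apply/fset0Pn; exists x; rewrite inE.
  rewrite addfsA [_ :+: [fset x] :+: _]addfsAC.
  apply/eqP/eqP => [|-> //]; move/(congr1 (fun Z => Z :+: [fset (- x)%R])).
  by rewrite -!addfsA !addfs11 addrN addr0 addfs0.
(* B is translated so that A ∩ B is a nonempty proper part of A. If no translate does this, all
   differences of A are periods of B, and A + B is a translate of B. *)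
have [[x /andP[I0 IA]]|noI] :=
  pselect (exists x, (A `&` (B :+: [fset x]) != fset0)
                  && ~~ (A `<=` B :+: [fset x])); last first.
  have st a a' : a \in A -> a' \in A -> B :+: [fset (a' - a)%R] = B.
    move=> aA a'A; apply: addfs_stable; apply/fsubsetP=> _ /addfsP[b bB [_ /fset1P-> ->]].
    apply: contrapT => /negP nb; apply: noI; exists (a - b)%R; apply/andP; split.
      by apply/fset0Pn; exists a; rewrite in_fsetI aA mem_addfs1 opprB addrC subrK.
    apply: contra nb => /fsubsetP/(_ _ a'A).
    by rewrite mem_addfs1 opprB addrCA.
  have /fset0Pn[a aA] := A0.
  have ABa : A :+: B = B :+: [fset a].
    apply/fsetP=> y; rewrite mem_addfs1; apply/addfsP/idP.
      case=> a' a'A [b bB ->]; have -> : (a' + b - a = b + (a' - a))%R.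
        by rewrite [(a' + b)%R]addrC addrA.
      by rewrite -(st _ _ aA a'A) mem_addfs ?inE.
    by move=> yB; exists a => //; exists (y - a)%R => //; rewrite addrC subrK.
  rewrite ABa card_addfs1 addnC leq_add2l.
  rewrite -(card_addfs1 A (- a)%R) fsubset_leq_card //.
  apply/fsubsetP=> y; rewrite mem_addfs1 opprK => yaA.
  rewrite mem_stab ?addfs_neq0 ?B0 /=; last by apply/fset0Pn; exists a; rewrite inE.
  by rewrite addfsAC -{2}(st _ _ aA yaA) addrK.
rewrite -(trB x) -(card_addfs1 B x) -(card_addfs1 (A :+: B) x) -addfsA.
have ABxn : #|` A :+: (B :+: [fset x])| <= n by rewrite addfsA card_addfs1.
have {trB B0} B0 : B :+: [fset x] != fset0.
  by rewrite addfs_neq0 B0; apply/fset0Pn; exists x; rewrite inE.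
move: (B :+: [fset x]) I0 IA ABxn B0 => {ABn x} {}B I0 IA ABn B0.
set I := A `&` B in I0; pose U := A `|` B.
(* Refines a convergent (C, H) until H stabilizes A + B. Then |C| <= |A + B|, |H| is at most the
   size of the stabilizer, and |I| + |U| = |A| + |B|. *)
have key k : forall C H, #|` H| < k -> fgroup H -> C != fset0 -> C `<=` A :+: B ->
    C :+: H = C -> #|` I| + #|` U :+: H| <= #|` C| + #|` H| ->
    #|` A| + #|` B| <= #|` A :+: B| + #|` stab (A :+: B)|.
  elim: k => // k IHk C H Hk gH C0 CAB CH conv.
  have AB0 : A :+: B != fset0 by rewrite addfs_neq0 A0.
  have [ABH|ABH] := eqVneq (A :+: B :+: H) (A :+: B).
    have := fsubset_leq_card (sub_stab AB0 ABH).
    have := fsubset_leq_card CAB.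
    have := fsubset_leq_card (sub_addfs_fgroup U gH).
    have := cardfsUI A B; rewrite -/I -/U; card_lia.
  have : ~~ (A :+: B :+: H `<=` A :+: B).
    by apply: contra ABH => sub; rewrite eqEfsubset sub sub_addfs_fgroup.
  case/fsubsetPn=> z /addfsP[_ /addfsP[a aA [b bB ->]] [y yH ->]] zAB.
  have zT : (a + b + y)%R \in [fset (a + b)%R] :+: H by rewrite mem_addfs ?inE.
  have IHs A' B' : A' != fset0 -> B' != fset0 ->
     #|` A' :+: B'| < #|` A :+: B| -> weak A' B'.
    by move=> A'0 B'0 lt; apply: IHn => //; apply: leq_trans ABn.
  have [D [J [[gJ JH JltH] [DAB CD DJ le]]]] := kneser_step gH C0 CAB CH IHs aA bB zT zAB.
  apply: (IHk (C `|` D) J) => //.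
  - by apply: leq_trans JltH _; rewrite -ltnS.
  - by case/fset0Pn: C0 => c cC; apply/fset0Pn; exists c; rewrite in_fsetU cC.
  - by rewrite fsubUset CAB.
  - by rewrite addfsUl DJ (addfs_fgroup_sub gJ JH CH).
  have := cardfsUI C D; rewrite CD cardfs0 addn0 => ->.
  by move: conv le; rewrite -/U; card_lia.
have U0 : U != fset0 by case/fset0Pn: A0 => a aA; apply/fset0Pn; exists a; rewrite in_fsetU aA.
have IU0 : I :+: U != fset0 by rewrite addfs_neq0 I0.
have IUAB : I :+: U `<=` A :+: B.
  apply/fsubsetP=> _ /addfsP[i /fsetIP[iA iB] [u /fsetUP[uA|uB] ->]].
    by rewrite addrC mem_addfs.
  by rewrite mem_addfs.
have gS := fgroup_stab IU0.
(* The first convergent is I + U with its stabilizer; its inequality is the inner induction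
   hypothesis, as |I| < |A|. *)
apply: (key _ _ _ (ltnSn _) gS IU0 IUAB (stabP IU0)).
have eIU : I :+: (U :+: stab (I :+: U)) = I :+: U by rewrite addfsA stabP.
have := IHm I (U :+: stab (I :+: U)); rewrite eIU; apply=> //.
- apply: leq_trans Am; apply: fproper_ltn_card.
  rewrite fproperEneq fsubsetIl andbT; apply: contra IA => /eqP <-.
  exact: fsubsetIr.
- by rewrite ltnS; apply: leq_trans ABn; exact: fsubset_leq_card.
- by rewrite addfs_neq0 U0 fgroup_neq0.
Qed.

(** Adding the stabilizer K to both A and B does not change A + B, so the weak form applies to A + K
    and B + K. *)
Theorem kneser A B : A != fset0 -> B != fset0 ->
  #|` A :+: stab (A :+: B)| + #|` B :+: stab (A :+: B)|
    <= #|` A :+: B| + #|` stab (A :+: B)|.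
Proof.
move=> A0 B0; have AB0 : A :+: B != fset0 by rewrite addfs_neq0 A0.
have gK := fgroup_stab AB0; set K := stab _ in gK *.
have := @kneser_weak (A :+: K) (B :+: K).
have -> : A :+: K :+: (B :+: K) = A :+: B.
  by rewrite addfsA (addfsAC A K) -addfsA fgroup_addfs // stabP.
by apply; rewrite addfs_neq0 ?A0 ?B0 fgroup_neq0.
Qed.

End Kneser.

(** * Minimal 2-fragments *)

Definition expanding (V : zmodType) (A : {fset V}) : Prop :=
  forall K, fgroup K -> 1 < #|` K| -> (exists x, x \notin K) ->
  #|` K| + #|` A| <= #|` A :+: K|.

(** For nonempty expanding [A], |X + A| - |X| is never below |A| - 1 when X is nonempty and X + A
    misses a point. The strict bound thus means that X attains the least possible value. *)
Definition fragment2 (V : zmodType) (A X : {fset V}) : Prop :=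
  [/\ 1 < #|` X|, #|` X :+: A| < #|` X| + #|` A|
    & exists y z, [/\ y != z, y \notin X :+: A & z \notin X :+: A]].

Definition sidon (V : zmodType) (M : {fset V}) : Prop :=
  forall x, x != 0%R -> #|` M `&` (M :+: [fset x])| <= 1.

Definition fprogression (V : zmodType) (d : V) (A : {fset V}) : Prop :=
  exists a j, forall x, (x \in A) <-> (exists2 i, i <= j & x = (a + d *+ i)%R).

Section FsetFacts.
Variable T : choiceType.
Implicit Types (A X : {fset T}) (x y : T).

Lemma cardfs_gt1P A :
  reflect (exists x y, [/\ x \in A, y \in A & x != y]) (1 < #|` A|).
Proof.
apply: (iffP idP) => [A1|[x [y [xA yA xy]]]]; last first.
  have : [fset x; y] `<=` A by rewrite fsubUset !fsub1set xA.
  by move/fsubset_leq_card; rewrite cardfs2 xy.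
have /fset0Pn[x xA] : A != fset0 by rewrite -cardfs_gt0; apply: leq_trans A1.
have /fset0Pn[y] : A `\ x != fset0.
  by rewrite -cardfs_gt0; move: A1; rewrite (cardfsD1 x) xA.
by rewrite !inE => /andP[yx yA]; exists x, y; rewrite eq_sym.
Qed.

Lemma fset_argmax A (f : T -> nat) : A != fset0 ->
  exists2 a, a \in A & forall b, b \in A -> f b <= f a.
Proof.
case/fset0Pn=> a0 a0A.
case: (@arg_maxnP A [` a0A] xpredT (fun i => f (val i)) isT) => a _ amax.
by exists (val a); [exact: valP | move=> b bA; exact: (amax [` bA])].
Qed.

Lemma fset_argmin A (f : T -> nat) : A != fset0 ->
  exists2 a, a \in A & forall b, b \in A -> f a <= f b.
Proof.
case/fset0Pn=> a0 a0A.
case: (@arg_minnP A [` a0A] xpredT (fun i => f (val i)) isT) => a _ amin.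
by exists (val a); [exact: valP | move=> b bA; exact: (amin [` bA])].
Qed.

Lemma ex_min_card (P : {fset T} -> Prop) : (exists A, P A) ->
  exists2 M, P M & forall A, P A -> #|` M| <= #|` A|.
Proof.
case=> A PA; have [n] := ubnP #|` A|; elim: n A PA => // n IHn A PA An.
have [[B [PB BA]]|noB] := pselect (exists B, P B /\ #|` B| < #|` A|).
  by apply: (IHn B) => //; apply: leq_trans BA _; rewrite -ltnS.
exists A => // B PB; rewrite leqNgt; apply/negP=> BA; apply: noB.
by exists B.
Qed.

End FsetFacts.

(** * Vosper's theorem for expanding sets *)

Section Vosper.
Variable V : zmodType.
Implicit Types (A B D I K M N R U X Y : {fset V}) (x y z d : V).

Lemma fgroupI K L : fgroup K -> fgroup L -> fgroup (K `&` L : {fset V}).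
Proof.
move=> gK gL; split; first by rewrite in_fsetI gK.1 gL.1.
by move=> x y /fsetIP[xK xL] /fsetIP[yK yL]; rewrite in_fsetI gK.2 ?gL.2.
Qed.

Lemma fgroup_trivial K : fgroup K -> #|` K| <= 1 -> K = [fset 0%R].
Proof.
case=> K0 _ K1; apply/eqP; rewrite eq_sym eqEfcard fsub1set K0 /=.
by rewrite cardfs1.
Qed.

Lemma fgroup_ex_neq0 K : fgroup K -> 1 < #|` K| -> exists2 x, x \in K & x != 0%R.
Proof.
move=> gK /cardfs_gt1P[x [y [xK yK xy]]]; exists (x - y)%R; first exact: gK.2.
by rewrite subr_eq0.
Qed.

Lemma fgroup_gt1 K x : fgroup K -> x \in K -> x != 0%R -> 1 < #|` K|.
Proof. by move=> [K0 _] xK x0; apply/cardfs_gt1P; exists x, 0%R. Qed.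

Lemma fgroupMn K x n : fgroup K -> x \in K -> (x *+ n)%R \in K.
Proof.
move=> gK xK; elim: n => [|n IHn]; first by rewrite mulr0n; case: gK.
by rewrite mulrS fgroupD.
Qed.

Lemma proper_period X K z :
  X != fset0 -> z \notin X -> X :+: K = X -> exists x, x \notin K.
Proof.
case/fset0Pn=> x xX zX XK; exists (z - x)%R; apply: contra zX => zxK.
by rewrite -XK -[z](subrK x) addrC mem_addfs.
Qed.

(** Kneser's theorem with K the stabilizer of X + A. If K is trivial this is the bound itself;
    otherwise K is proper because of z, and |A + K| >= |A| + |K| gives even more. *)
Lemma expanding_isoperimetric A X z : expanding A -> A != fset0 -> X != fset0 ->
  z \notin X :+: A -> #|` X| + #|` A| <= (#|` X :+: A|).+1.
Proof.
move=> gA A0 X0 zXA; have := kneser X0 A0.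
have XA0 : X :+: A != fset0 by rewrite addfs_neq0 X0.
have gK := fgroup_stab XA0; have XAK := stabP XA0; set K := stab _ in gK XAK *.
have := fsubset_leq_card (sub_addfs_fgroup A gK).
have := fsubset_leq_card (sub_addfs_fgroup X gK).
have [K1|K1] := leqP #|` K| 1; first card_lia.
have := gA K gK K1 (proper_period XA0 zXA XAK); card_lia.
Qed.

(** Uncrossing: by [trM], a translate of a smallest fragment M meeting M in two points equals M. It
    remains to see that M has no nonzero period. *)
Lemma expanding_atom A : expanding A -> A != fset0 -> (exists X, fragment2 A X) ->
  exists2 M, fragment2 A M & sidon M.
Proof.
move=> gA A0 /ex_min_card[M fM minM]; exists M => //.
have [M1 MA [y [z [yz yMA zMA]]]] := fM.
have M0 : M != fset0 by rewrite -cardfs_gt0; apply: leq_trans M1.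
have isoM := expanding_isoperimetric gA A0 M0 yMA.
have trM x : 1 < #|` M `&` (M :+: [fset x])| -> M :+: [fset x] = M.
  move=> I1; apply: contrapT => Mx.
  set I := M `&` _ in I1; pose U := M `|` (M :+: [fset x]).
  have cUI : (#|` U| + #|` I| = #|` M| + #|` M|)%N.
    by rewrite cardfsUI card_addfs1.
  have ltIM : #|` I| < #|` M|.
    apply: fproper_ltn_card; rewrite fproperEneq fsubsetIl andbT.
    apply/eqP=> IM; apply: Mx; apply/eqP; rewrite eq_sym eqEfcard card_addfs1 leqnn.
    by rewrite andbT -{1}IM fsubsetIr.
  have IAM : I :+: A `<=` M :+: A by rewrite addfsS ?fsubsetIl.
  have isoI : #|` I| + #|` A| <= #|` I :+: A|.
    rewrite leqNgt; apply/negP=> IA; have := ltIM; rewrite ltnNge minM //.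
    split=> //; exists y, z; split=> //; [apply: contra yMA|apply: contra zMA].
      exact: (fsubsetP IAM).
    exact: (fsubsetP IAM).
  (* Submodularity: I + A lies in both M + A and its translate, whose union is U + A. *)
  have cUA : #|` U :+: A| + #|` I :+: A| <= #|` M :+: A| + #|` M :+: A|.
    have := cardfsUI (M :+: A) (M :+: A :+: [fset x]); rewrite card_addfs1 => <-.
    rewrite addfsUl (addfsAC M [fset x]) leq_add2l fsubset_leq_card // fsubsetI IAM.
    by rewrite (addfsAC M A) addfsS // fsubsetIr.
  have U0 : U != fset0.
    by case/fset0Pn: M0 => m mM; apply/fset0Pn; exists m; rewrite in_fsetU mM.
  (* Since I is too small to be a fragment, |U + A| <= |U| + |A| - 2, which the isoperimetric bound
     allows only if U + A is the whole group. Hence the group is finite. *)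
  have fullF w : w \in U :+: A.
    apply: contrapT => /negP wU; have := expanding_isoperimetric gA A0 U0 wU; card_lia.
  (* The complement of M + A, negated, is another fragment. *)
  set F := U :+: A in fullF cUA; pose D := F `\` (M :+: A).
  pose N := [fset (- v)%R | v in D].
  have cN : #|` N| = #|` D| by rewrite card_imfset //; exact: oppr_inj.
  have cD : (#|` D| + #|` M :+: A| = #|` F|)%N.
    rewrite cardfsDS ?subnK ?fsubset_leq_card //; apply/fsubsetP=> w _; exact: fullF.
  pose M' := [fset (- v)%R | v in M].
  have cM' : #|` M'| = #|` M| by rewrite card_imfset //; exact: oppr_inj.
  have NM w : w \in M -> (- w)%R \notin N :+: A.
    move=> wM; apply/negP => /addfsP[_ /imfsetP[v /= vD ->] [a aA e]].
    move: vD; rewrite in_fsetD => /andP[/negP + _]; apply.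
    have -> : v = (w + a)%R by rewrite -[w]opprK e opprD opprK -addrA addNr addr0.
    exact: mem_addfs.
  have cNA : #|` N :+: A| + #|` M| <= #|` F|.
    rewrite -cM' -cardfsUI; have -> : N :+: A `&` M' = fset0.
      apply/eqP/fdisjointP=> v vNA; apply/negP=> /imfsetP[w /= wM e].
      by move: (NM w wM); rewrite -e vNA.
    by rewrite cardfs0 addn0 fsubset_leq_card //; apply/fsubsetP=> w _; exact: fullF.
  have fN : fragment2 A N.
    split; first 1 last.
    - card_lia.
    - case/cardfs_gt1P: M1 => u [v [uM vM uv]]; exists (- u)%R, (- v)%R.
      by rewrite !NM // (inj_eq oppr_inj).
    rewrite cN; apply/cardfs_gt1P; exists y, z.
    by rewrite !in_fsetD yMA zMA !fullF.
  have := minM N fN; card_lia.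
have gK := fgroup_stab M0; have MK := stabP M0.
have [K1|K1] := leqP #|` stab M| 1; last first.
  have /fset0Pn[m mM] := M0.
  have [k kK k0] := fgroup_ex_neq0 gK K1.
  (* With k a nonzero period, M + (m' - m) contains m' and m' + k, two points of M. By [trM], m' - m
     is a period, so M is a coset, which contradicts that A is expanding. *)
  have Mm : M = [fset m] :+: stab M.
    apply/eqP; rewrite eqEfsubset; apply/andP; split; last first.
      by rewrite -{2}MK addfsS // fsub1set.
    apply/fsubsetP=> m' m'M; rewrite mem_coset mem_stab //; apply/eqP/trM.
    have m'k : (m' + k)%R \in M by rewrite -MK mem_addfs.
    apply/cardfs_gt1P; exists m', (m' + k)%R.
    rewrite !in_fsetI !mem_addfs1 m'M m'k; split=> /=.
    - by rewrite opprB addrC subrK.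
    - by rewrite opprB addrC addrA subrK -MK mem_addfs.
    - by rewrite eq_sym -subr_eq0 addrAC addrN add0r.
  have := gA _ gK K1 (proper_period (X := M :+: A) _ yMA _).
  have cM : #|` M| = #|` stab M| by rewrite {1}Mm card_coset.
  have cMA : #|` M :+: A| = #|` A :+: stab M|.
    by rewrite {1}Mm -addfsA addfsC card_addfs1 addfsC.
  rewrite addfs_neq0 M0 A0 addfsAC MK => /(_ isT erefl); card_lia.
move=> x x0; rewrite leqNgt; apply: contra x0 => /trM/eqP.
by rewrite -mem_stab // (fgroup_trivial gK K1) inE.
Qed.

(** M meets two cosets of K, so |M + K| >= 2|K|. Also |M + K| >= 2|M| - 1, since M + K contains M
    and M + k for a nonzero k in K. If the bound failed, these would give both |K| < |M| and |M| <=
    |K|. *)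
Lemma sidon_coset M K x y : sidon M -> fgroup K -> 1 < #|` K| ->
  x \in M -> y \in M -> (x - y)%R \notin K -> #|` K| + #|` M| <= #|` M :+: K|.
Proof.
move=> sM gK K1 xM yM xyK; rewrite leqNgt; apply/negP=> lt.
have two : #|` K| + #|` K| <= #|` M :+: K|.
  have := cardfsUI ([fset x] :+: K) ([fset y] :+: K).
  have /eqP -> := coset_disjoint gK xyK; rewrite cardfs0 addn0 !card_coset => <-.
  by rewrite fsubset_leq_card // fsubUset !addfsS ?fsub1set.
have [k kK k0] := fgroup_ex_neq0 gK K1.
have := cardfsUI M (M :+: [fset k]); rewrite card_addfs1.
have : M `|` (M :+: [fset k]) `<=` M :+: K.
  by rewrite fsubUset sub_addfs_fgroup // addfsS // fsub1set.
move/fsubset_leq_card; have := sM k k0; card_lia.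
Qed.

Lemma sidon_addfs2 M x y : sidon M -> x != y ->
  #|` M| + #|` M| <= #|` (M :+: [fset x]) `|` (M :+: [fset y])| + 1.
Proof.
move=> sM xy; have := cardfsUI (M :+: [fset x]) (M :+: [fset y]).
rewrite !card_addfs1 => <-; rewrite leq_add2l.
have yx0 : (y - x)%R != 0%R by rewrite subr_eq0 eq_sym.
rewrite -(card_addfs1 _ (- x)%R); apply: leq_trans (sM _ yx0).
apply: fsubset_leq_card; apply/fsubsetP=> z.
rewrite !(mem_addfs1, in_fsetI) !opprK addrK => /andP[-> ] /=.
by rewrite opprB addrA.
Qed.

(** Three translates of M that pairwise share at most one point. *)
Lemma sidon_addfs3 M N : sidon M -> 2 < #|` N| ->
  3 * #|` M| <= #|` M :+: N| + 3.
Proof.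
move=> sM N3; have /cardfs_gt1P[x [y [xN yN xy]]] := ltnW N3.
have /fset0Pn[z] : N `\` [fset x; y] != fset0.
  rewrite -cardfs_gt0 cardfsDS ?fsubUset ?fsub1set ?xN // cardfs2 xy; card_lia.
rewrite in_fsetD !inE negb_or => /andP[/andP[zx zy] zN].
pose T t := M :+: [fset t].
have sub : (T x `|` T y) `|` T z `<=` M :+: N.
  by rewrite !fsubUset !addfsS ?fsub1set.
have := fsubset_leq_card sub; have := cardfsUI (T x `|` T y) (T z).
have := sidon_addfs2 sM xy; have := sidon_addfs2 sM zx; have := sidon_addfs2 sM zy.
have := cardfsUI (T z) (T x); have := cardfsUI (T z) (T y).
have := cardfsU_le (T x `&` T z) (T y `&` T z).
rewrite -fsetIUl [_ `&` T x]fsetIC [_ `&` T y]fsetIC !card_addfs1 -!/(T _); card_lia.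
Qed.

Lemma addfs_coset_sub A K x : fgroup K -> A `<=` [fset x] :+: K ->
  A :+: K `<=` [fset x] :+: K.
Proof.
move=> gK AK; rewrite -{2}(fgroup_addfs gK) addfsA; exact: addfsS.
Qed.

(* A fragment of an expanding set is not contained in a coset of a proper subgroup:
   over such a coset K + m, all but one of the K-components of A would be full. *)
Lemma fragment2_not_coset A M K m :
  expanding A -> fragment2 A M -> sidon M -> A != fset0 ->
  fgroup K -> (exists x, x \notin K) -> M `<=` [fset m] :+: K -> m \in M -> False.
Proof.
move=> gA fM sM A0 gK0 pK0 MK0 mM.
have [M1 MA [z [_ [_ zMA _]]]] := fM.
(* K is taken minimal so that a subgroup of K with a coset containing M must be K itself. *)
have [|{K gK0 pK0 MK0}K [gK pK MK] minK] := @ex_min_card V (fun K =>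
  [/\ fgroup K, exists x, x \notin K & M `<=` [fset m] :+: K]); first by exists K.
have cMK : #|` M| <= #|` K| by rewrite -(card_coset K m) fsubset_leq_card.
have M0 : M != fset0 by apply/fset0Pn; exists m.
have K1 : 1 < #|` K| by apply: leq_trans cMK.
have subK L : fgroup L -> L `<=` K -> M `<=` [fset m] :+: L -> L = K.
  move=> gL LK ML; apply/eqP; rewrite eqEfcard LK minK //; split=> //.
  by case: pK => x xK; exists x; apply: contra xK; apply: (fsubsetP LK).
have gAK := gA _ gK K1 pK.
(* If all cosets a + m + K were in A + M, then |A + K| <= |A + M| < |M| + |A| <= |K| + |A|. *)
have [[a [aA nfull]]|allfull] :=
  pselect (exists a, a \in A /\ ~~ ([fset (a + m)%R] :+: K `<=` A :+: M)); last first.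
  suff : (A :+: K) :+: [fset m] `<=` A :+: M.
    move/fsubset_leq_card; rewrite card_addfs1; move: MA; rewrite addfsC; card_lia.
  apply/fsubsetP=> _ /addfsP[_ /addfsP[a aA [k kK ->]] [_ /fset1P -> ->]].
  have /fsubsetP : [fset (a + m)%R] :+: K `<=` A :+: M.
    by apply: contrapT => /negP nf; apply: allfull; exists a.
  by apply; rewrite addrAC mem_addfs ?inE.
pose Aa := A `&` ([fset a] :+: K); pose R := A `\` ([fset a] :+: K).
have cA : (#|` Aa| + #|` R| = #|` A|)%N by exact: cardfsID.
have aAa : a \in Aa by rewrite in_fsetI aA coset_id.
have Aa0 : Aa != fset0 by apply/fset0Pn; exists a.
have AaM : Aa :+: M `<=` [fset (a + m)%R] :+: K.
  rewrite -addfs11 -(fgroup_addfs gK) addfsA (addfsAC [fset a]) -addfsA.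
  by rewrite addfsS // fsubsetIr.
have disj : (Aa :+: M) `&` (R :+: M) = fset0.
  apply/eqP/fdisjointP=> y yAM; apply/negP=> /addfsP[r + [n nM ey]].
  rewrite in_fsetD => /andP[/negP + _]; apply.
  move: (fsubsetP AaM _ yAM) (fsubsetP MK _ nM); rewrite !mem_coset ey => h1 h2.
  have := gK.2 _ _ h1 h2; congr (_ \in K).
  by rewrite opprD !addrA opprB addrA subrK addrAC addrK.
have AaM0 : Aa :+: M != fset0 by rewrite addfs_neq0 Aa0.
(* Kneser's theorem with stabilizer L inside K. If L is nontrivial, either M meets two cosets of L
   and [sidon_coset] applies, or L = K and the coset of a + m would be full. *)
have cAaM : #|` Aa| + #|` M| <= #|` Aa :+: M| + 1.
  have := kneser Aa0 M0; have gL := fgroup_stab AaM0; have AaML := stabP AaM0.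
  have LK := stab_sub_coset gK AaM0 AaM.
  set L := stab _ in gL AaML LK *.
  have := fsubset_leq_card (sub_addfs_fgroup Aa gL).
  have := fsubset_leq_card (sub_addfs_fgroup M gL).
  have [L1|L1] := leqP #|` L| 1; first card_lia.
  have [[n [nM nL]]|ML] := pselect (exists n, n \in M /\ (n - m)%R \notin L).
    have := sidon_coset sM gL L1 nM mM nL; card_lia.
  have eLK : L = K.
    apply: subK => //; apply/fsubsetP=> n nM; rewrite mem_coset.
    by apply: contrapT => /negP nL; apply: ML; exists n.
  move/negP: nfull; case; rewrite eLK in AaML.
  apply: fsubset_trans (_ : Aa :+: M `<=` _); last by rewrite addfsS ?fsubsetIl.
  by rewrite -AaML addfsS // fsub1set mem_addfs.
have AMU : A :+: M = (Aa :+: M) `|` (R :+: M) by rewrite -addfsUl fsetID.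
have cRM : #|` R :+: M| <= #|` R|.
  have := cardfsUI (Aa :+: M) (R :+: M); rewrite -AMU disj cardfs0.
  by move: MA; rewrite addfsC; card_lia.
(* From |R + M| <= |R| one gets R + M = R + m, so the differences n - m for n in M are periods of R.
   They lie in K ∩ stab R, which is K by minimality. *)
have RK : R :+: K = R.
  have [->|R0] := eqVneq R fset0.
    by apply/eqP; rewrite -[_ == _]negbK addfs_neq0 eqxx.
  have RMm : R :+: M = R :+: [fset m].
    by apply/eqP; rewrite eq_sym eqEfcard addfsS ?fsub1set // card_addfs1.
  have gL := fgroupI gK (fgroup_stab R0).
  rewrite -{1}(subK _ gL (fsubsetIl _ _)).
    by apply: addfs_fgroup_sub (fsubsetIr _ _) (stabP R0).
  apply/fsubsetP=> n nM; rewrite mem_coset in_fsetI mem_stab //.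
  rewrite -mem_coset (fsubsetP MK) //=; apply/eqP/addfs_stable/fsubsetP=> y.
  rewrite mem_addfs1 => yR; have : (y + m)%R \in R :+: M.
    have -> : (y + m = y - (n - m) + n)%R by rewrite opprB addrA subrK.
    exact: mem_addfs.
  by rewrite RMm mem_addfs1 addrK.
suff : A :+: K `<=` R `|` ([fset a] :+: K).
  move/fsubset_leq_card; have := cardfsU_le R ([fset a] :+: K).
  have : 0 < #|` Aa| by rewrite cardfs_gt0.
  rewrite card_coset; card_lia.
rewrite -{1}(fsetID ([fset a] :+: K) A) addfsUl fsubUset RK fsubsetUl andbT.
apply: fsubset_trans (fsubsetUr _ _); apply: addfs_coset_sub => //; exact: fsubsetIr.
Qed.

Lemma expanding_sidon A M :
  expanding A -> fragment2 A M -> sidon M -> A != fset0 -> expanding M.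
Proof.
move=> gA fM sM A0 K gK K1 pK; have [M1 _ _] := fM.
have /fset0Pn[m mM] : M != fset0 by rewrite -cardfs_gt0; apply: leq_trans M1.
have [[n [nM nK]]|MK] := pselect (exists n, n \in M /\ (n - m)%R \notin K).
  exact: sidon_coset nM mM nK.
case: (fragment2_not_coset gA fM sM A0 gK pK _ mM); apply/fsubsetP=> n nM.
by rewrite mem_coset; apply: contrapT => /negP nK; apply: MK; exists n.
Qed.

(* If the atom M of A had more than two elements, M would be expanding and have an
   atom N; two Sidon sets cannot satisfy |M + N| < |M| + |N|. *)
Lemma expanding_fragment2_difference A :
  expanding A -> 1 < #|` A| -> (exists X, fragment2 A X) ->
  exists2 d, d != 0%R & #|` A `|` (A :+: [fset d])| <= #|` A| + 1.
Proof.
move=> gA A1 /(expanding_atom gA)[|M fM sM].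
  by rewrite -cardfs_gt0; apply: leq_trans A1.
have A0 : A != fset0 by rewrite -cardfs_gt0; apply: leq_trans A1.
have [M1 MA [u [v [uv uMA vMA]]]] := fM.
have M0 : M != fset0 by rewrite -cardfs_gt0; apply: leq_trans M1.
have [M3|M2] := ltnP 2 #|` M|.
  have gM := expanding_sidon gA fM sM A0.
  have [|N [N1 NM _] sN] := expanding_atom gM M0.
    exists A; split=> //; first by rewrite addfsC addnC.
    by exists u, v; rewrite addfsC.
  (* A two-element N would give |N + M| >= 2|M| - 1 >= |M| + 2, as |M| >= 3. *)
  have N2 : 2 < #|` N|.
    rewrite ltnNge; apply/negP=> N2; case/cardfs_gt1P: (N1) => x [y [xN yN xy]].
    have := sidon_addfs2 sM xy.
    have : (M :+: [fset x]) `|` (M :+: [fset y]) `<=` N :+: M.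
      by rewrite [N :+: M]addfsC fsubUset !addfsS ?fsub1set.
    move/fsubset_leq_card; card_lia.
  (* Adding the two bounds and using |M + N| < |M| + |N| leaves |M| + |N| <= 4. *)
  have := sidon_addfs3 sM N2; have := sidon_addfs3 sN M3.
  rewrite [M :+: N]addfsC; card_lia.
case/cardfs_gt1P: (M1) => x [y [xM yM xy]].
exists (y - x)%R; first by rewrite subr_eq0 eq_sym.
rewrite -(card_addfs1 _ x) addfsUl -addfsA addfs11 subrK.
apply: leq_trans (_ : #|` M :+: A| <= _); last card_lia.
by rewrite [M :+: A]addfsC fsubset_leq_card // fsubUset !addfsS ?fsub1set.
Qed.

(** At most one element e of B satisfies e + d ∉ B. Adding d repeatedly to an element of B thus
    either reaches e or never leaves B; R collects the elements that never reach e. *)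
Lemma progression_or_periodic B d : B != fset0 ->
  #|` B `|` (B :+: [fset d])| <= #|` B| + 1 ->
  fprogression d B \/
  exists R e, [/\ R != fset0, R `<=` B, R :+: [fset d] = R
    & forall x, x \in B -> x \notin R -> exists i, (x + d *+ i)%R = e].
Proof.
move=> B0 cB.
have [Bd|] := boolP (B :+: [fset d] `<=` B).
  (* With R = B the condition on e is vacuous, so 0 is an arbitrary choice. *)
  right; exists B, 0%R; split=> //; first exact: addfs_stable.
  by move=> x ->.
case/fsubsetPn=> _ /addfsP[e eB [_ /fset1P -> ->]] edB.
have eP b : b \in B -> (b + d)%R \notin B -> b = e.
  move=> bB bdB; apply: contrapT => /eqP be.
  suff : #|` B| + 2 <= #|` B `|` (B :+: [fset d])| by card_lia.
  have : B `|` [fset (b + d)%R; (e + d)%R] `<=` B `|` (B :+: [fset d]).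
    by rewrite fsetUS // fsubUset !fsub1set !mem_addfs ?inE.
  move/fsubset_leq_card; apply: leq_trans.
  have := cardfsUI B [fset (b + d)%R; (e + d)%R].
  have -> : B `&` [fset (b + d)%R; (e + d)%R] = fset0.
    apply/eqP/fdisjointP=> x xB; rewrite !inE negb_or.
    by apply/andP; split; apply: contraTneq xB => ->.
  by rewrite cardfs0 addn0 => ->; rewrite cardfs2 (inj_eq (addIr d)) be.
pose R := [fset x in B | ~~ `[< exists i, (x + d *+ i)%R = e >]].
have RP x : (x \in R) = (x \in B) && ~~ `[< exists i, (x + d *+ i)%R = e >].
  by rewrite !inE.
have [R0|R0] := eqVneq R fset0; last first.
  right; exists R, e; split=> //.
  - by apply/fsubsetP=> x; rewrite RP => /andP[].
  - apply/addfs_stable/fsubsetP=> _ /addfsP[r + [_ /fset1P -> ->]].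
    rewrite !RP => /andP[rB /asboolPn nr]; apply/andP; split.
      apply: contrapT => /negP rdB; apply: nr; exists 0.
      by rewrite mulr0n addr0 (eP r).
    by apply/asboolPn => -[i ei]; apply: nr; exists i.+1; rewrite mulrS addrA.
  - by move=> x xB; rewrite RP xB /= negbK => /asboolP.
left.
have Be b : b \in B -> exists i, (b + d *+ i)%R == e.
  move=> bB; have : b \notin R by rewrite R0 inE.
  by rewrite RP bB /= negbK => /asboolP[i ei]; exists i; apply/eqP.
(* The least number of steps from b to e. The element b0 farthest from e is the first term of the
   progression. *)
pose f b := if pselect (exists i, (b + d *+ i)%R == e) is left ex then ex_minn ex else 0.
have fP b : b \in B -> (b + d *+ f b)%R = e /\ forall i, (b + d *+ i)%R = e -> f b <= i.
  move=> bB; rewrite /f; case: pselect => [ex|[]]; last exact: Be.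
  by case: ex_minnP => i /eqP ei mini; split=> // k ek; apply: mini; apply/eqP.
have [b0 b0B maxb] := fset_argmax f B0.
have [eb0 minb0] := fP _ b0B.
have inB k : k <= f b0 -> (b0 + d *+ k)%R \in B.
  elim: k => [|k IHk] lek; first by rewrite mulr0n addr0.
  rewrite mulrSr addrA; apply: contrapT => /negP nB.
  have := eP _ (IHk (ltnW lek)) nB => /minb0; card_lia.
exists b0, (f b0) => x; split=> [xB|[i lei ->]]; last exact: inB.
exists (f b0 - f x); first exact: leq_subr.
have [ex _] := fP _ xB; apply: (addIr (d *+ f x)%R).
by rewrite ex -addrA -mulrnDr subnK ?maxb.
Qed.

Lemma fgroup_of_period R d : R != fset0 -> R :+: [fset d] = R ->
  exists2 K, fgroup K & d \in K /\ R :+: K = R.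
Proof.
move=> R0 Rd; exists (stab R); first exact: fgroup_stab.
by split; rewrite ?mem_stab ?stabP //; apply/eqP.
Qed.

(** In the periodic case d lies in a subgroup K with R + K = R, and A + K is within R ∪ (e + K).
    Then |A + K| < |A| + |K|, which is excluded. *)
Lemma expanding_vosper A z : expanding A -> 1 < #|` A| -> z \notin A ->
  (exists X, fragment2 A X) -> exists2 d, d != 0%R & fprogression d A.
Proof.
move=> gA A1 zA fA; have [d d0 cA] := expanding_fragment2_difference gA A1 fA.
have A0 : A != fset0 by rewrite -cardfs_gt0; apply: leq_trans A1.
exists d => //; case: (progression_or_periodic A0 cA) => // -[R [e [R0 RA Rd Re]]].
have [|K [gK dK RK] minK] := @ex_min_card V (fun K =>
  [/\ fgroup K, d \in K & R :+: K = R]).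
  by have [K gK [dK RK]] := fgroup_of_period R0 Rd; exists K.
have K1 := fgroup_gt1 gK dK d0.
have zR : z \notin R by apply: contra zA; apply: (fsubsetP RA).
have := gA K gK K1 (proper_period R0 zR RK).
have AsubR : A :+: K `<=` R `|` ([fset e] :+: K).
  apply/fsubsetP=> _ /addfsP[x xA [k kK ->]]; rewrite in_fsetU.
  have [xR|xR] := boolP (x \in R); first by rewrite -RK mem_addfs.
  have [i <-] := Re x xA xR; apply/orP; right.
  by rewrite mem_coset opprD addrA [(x + k)%R]addrC addrK gK.2 // fgroupMn.
have [eAR|] := eqVneq A R; first by rewrite eAR RK; card_lia.
move=> AR; have : #|` R| < #|` A|.
  by apply: fproper_ltn_card; rewrite fproperEneq eq_sym AR.
move: (fsubset_leq_card AsubR); have := cardfsU_le R ([fset e] :+: K).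
rewrite card_coset; card_lia.
Qed.

Lemma expanding_aperiodic A B z : expanding A -> A != fset0 -> B != fset0 ->
  #|` A :+: B| < #|` A| + #|` B| -> z \notin A :+: B ->
  #|` stab (A :+: B)| <= 1.
Proof.
move=> gA A0 B0 cAB zAB; have AB0 : A :+: B != fset0 by rewrite addfs_neq0 A0.
rewrite leqNgt; apply/negP=> K1; have gK := fgroup_stab AB0.
have := gA _ gK K1 (proper_period AB0 zAB (stabP AB0)).
have := kneser A0 B0; have := fsubset_leq_card (sub_addfs_fgroup B gK); card_lia.
Qed.

(** Y + i and A' + B are disjoint, so |Y| >= 2 gives |A' + B| <= |A'| + |B| - 2, and by Kneser A' +
    B has a nontrivial stabilizer K. Lower bounds on |A' + K| and |B + K| then contradict Kneser's
    theorem. *)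
Lemma expanding_unique_expression A B i z : expanding A -> 1 < #|` A| -> B != fset0 ->
  #|` A :+: B| < #|` A| + #|` B| -> z \notin A :+: B -> i \in A ->
  #|` [fset j in B | (i + j)%R \notin (A `\ i) :+: B]| <= 1.
Proof.
move=> gA A1 B0 cAB zAB iA; set A' := A `\ i; set Y := [fset _ in _ | _].
have cA : (#|` A| = #|` A'|.+1)%N by rewrite (cardfsD1 i) iA.
have A'0 : A' != fset0 by rewrite -cardfs_gt0; card_lia.
have YP j : (j \in Y) = (j \in B) && ((i + j)%R \notin A' :+: B) by rewrite !inE.
have disj : (A' :+: B) `&` (Y :+: [fset i]) = fset0.
  apply/eqP/fdisjointP=> x xAB; apply/negP; rewrite mem_addfs1 YP [(i + _)%R]addrC subrK xAB.
  by rewrite andbF.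
have YB : Y `<=` B by apply/fsubsetP=> j; rewrite YP => /andP[].
have cY : #|` A' :+: B| + #|` Y| <= #|` A :+: B|.
  have := cardfsUI (A' :+: B) (Y :+: [fset i]); rewrite disj cardfs0 card_addfs1 addn0.
  move=> <-; rewrite fsubset_leq_card // fsubUset addfsS ?fsubsetDl //=.
  by rewrite addfsC addfsS // fsub1set.
have AB0 : A' :+: B != fset0 by rewrite addfs_neq0 A'0.
have gK := fgroup_stab AB0; have ABK := stabP AB0.
rewrite leqNgt; apply/negP=> Y1; have := kneser A'0 B0.
set K := stab _ in gK ABK *.
have := fsubset_leq_card (sub_addfs_fgroup B gK).
have := fsubset_leq_card (sub_addfs_fgroup A' gK).
have [K1|K1] := leqP #|` K| 1; first card_lia.
have zAB' : z \notin A' :+: B.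
  by apply: contra zAB; apply/fsubsetP/addfsS; rewrite ?fsubsetDl.
have := gA K gK K1 (proper_period AB0 zAB' ABK).
have : #|` A :+: K| <= #|` A' :+: K| + #|` K|.
  rewrite -(card_coset K i); apply: leq_trans (cardfsU_le _ _).
  by rewrite -addfsUl fsetUC fsetD1K.
(* As A' + B is K-periodic, membership in Y depends only on the K-coset; hence |B + K| >= |B| + |K|
   - |Y|. *)
have YK : B `&` (Y :+: K) `<=` Y.
  apply/fsubsetP=> j /fsetIP[jB /addfsP[y yY [k kK ej]]]; rewrite YP jB /=.
  move: yY; rewrite YP => /andP[_]; apply: contra => ijAB.
  have -> : (i + y = (i + j) + - k)%R by rewrite ej addrA addrK.
  by rewrite -ABK mem_addfs // fgroupN.
have := cardfsUI B (Y :+: K); have := fsubset_leq_card YK.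
have : B `|` (Y :+: K) `<=` B :+: K by rewrite fsubUset sub_addfs_fgroup // addfsS.
move/fsubset_leq_card.
have : #|` K| <= #|` Y :+: K|.
  by rewrite addfsC leq_card_addfs // -cardfs_gt0; apply: leq_trans Y1.
card_lia.
Qed.

(** A step d is moved from A to B: A' + B' = A + B with |A'| >= |A| - 1. Since A + B is aperiodic,
    Kneser's theorem gives |B'| <= |B| + 1. *)
Lemma expanding_progression A B d z : expanding A -> 0%R \in A -> 1 < #|` A| -> B != fset0 ->
  #|` A :+: B| < #|` A| + #|` B| -> z \notin A :+: B -> d != 0%R ->
  fprogression d A -> fprogression d B.
Proof.
move=> gA A0 A1 B0 cAB zAB d0 [a [n An]].
have An0 : A != fset0 by apply/fset0Pn; exists 0%R.
have cK := expanding_aperiodic gA An0 B0 cAB zAB.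
pose A' := [fset x in A | (x + d)%R \in A]; pose B' := B `|` (B :+: [fset d]).
have A'P x : (x \in A') = (x \in A) && ((x + d)%R \in A) by rewrite !inE.
have A'n i : i < n -> (a + d *+ i)%R \in A'.
  move=> lin; rewrite A'P; apply/andP; split; apply/An.
    by exists i => //; exact: ltnW.
  by exists i.+1 => //; rewrite mulrSr addrA.
have cA' : #|` A| <= #|` A'| + 1.
  rewrite -(cardfs1 (a + d *+ n)%R); apply: leq_trans (cardfsU_le _ _).
  apply: fsubset_leq_card; apply/fsubsetP=> x /An[i lei ->]; rewrite in_fsetU in_fset1.
  by move: lei; rewrite leq_eqVlt => /orP[/eqP -> |/A'n ->]; rewrite ?eqxx ?orbT.
have A'0 : A' != fset0 by rewrite -cardfs_gt0; card_lia.
have B'0 : B' != fset0.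
  by case/fset0Pn: B0 => b bB; apply/fset0Pn; exists b; rewrite in_fsetU bB.
have n0 : 0 < n.
  rewrite lt0n; apply/eqP=> en; case/cardfs_gt1P: A1 => x [y [/An[i + ->] /An[j + ->]]].
  by rewrite en !leqn0 => /eqP -> /eqP ->; rewrite eqxx.
have eAB : A' :+: B' = A :+: B.
  apply/eqP; rewrite eqEfsubset; apply/andP; split; apply/fsubsetP=> _ /addfsP[x + [y + ->]].
    rewrite A'P in_fsetU mem_addfs1 => /andP[xA xdA] /orP[] yB; first exact: mem_addfs.
    have -> : (x + y = (x + d) + (y - d))%R by rewrite addrACA addrN addr0.
    exact: mem_addfs.
  move=> /An[i lei ->] yB; move: lei; rewrite leq_eqVlt => /orP[/eqP ->|lei].
    have -> : (a + d *+ n + y = (a + d *+ n.-1) + (y + d))%R.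
      have -> : (d *+ n = d *+ n.-1 + d)%R by rewrite -mulrSr prednK.
      by rewrite -!addrA [(d + y)%R]addrC.
    by rewrite mem_addfs ?A'n ?ltn_predL // in_fsetU !mem_addfs ?inE ?orbT.
  by rewrite mem_addfs ?A'n // in_fsetU yB.
have cB' : #|` B'| <= #|` B| + 1.
  have := kneser A'0 B'0; rewrite eAB; set K := stab _ in cK *.
  have gK : fgroup K by apply: fgroup_stab; rewrite addfs_neq0 An0.
  have := fsubset_leq_card (sub_addfs_fgroup B' gK).
  have := fsubset_leq_card (sub_addfs_fgroup A' gK); card_lia.
case: (progression_or_periodic B0 cB') => // -[R [_ [R0 RB Rd _]]].
have [K gK [dK RK]] := fgroup_of_period R0 Rd.
have zR : (z \notin R).
  apply: contra zAB => zR; rewrite -[z]add0r mem_addfs //; exact: (fsubsetP RB).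
have K1 := fgroup_gt1 gK dK d0.
(* A progression through 0 with difference d in K lies in K, so |A + K| <= |K| contradicts that A is
   expanding. *)
have AK : A `<=` K.
  have /An[i0 _ e0] := A0.
  apply/fsubsetP=> _ /An[i _ ->].
  have -> : (a = - (d *+ i0))%R by apply/eqP; rewrite -addr_eq0 -e0.
  by rewrite addrC gK.2 // fgroupMn.
have := gA K gK K1 (proper_period R0 zR RK).
have : A :+: K `<=` K by rewrite -{2}(fgroup_addfs gK) addfsS.
move/fsubset_leq_card; card_lia.
Qed.

End Vosper.

(** * Sizes of the components *)

(** Here s = |A|, t = |B|, N = |A + B| = |Q|, h = |H| and E = |S + T|; k and m are the extreme sizes
    of the components of S. With u = N - t, the hypotheses give 2(h - m) < k and 2u < t, which make
    E exceed two thirds of N h. *)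
Lemma arith_large (N t s m k h E R : nat) :
  2 < s -> N < s + t -> t <= N -> 3 * s <= N + 2 ->
  k <= m -> m <= h -> R <= s.-1 * m -> s * h < k + R + h ->
  t * m + (N - t) * k <= E -> 3 * E <= 2 * (N * h) + 2 -> False.
Proof.
case: s => [|[|[|s]]] // _ Nst tN sN km mh.
rewrite /= => RR SS.
have [u eN] : exists u, N = (t + u)%N by exists (N - t); lia.
have [x em] : exists x, m = (k + x)%N by exists (m - k); lia.
have [y eh] : exists y, h = (m + y)%N by exists (h - m); lia.
subst N m h; rewrite (_ : t + u - t = u)%N; last lia.
have k2 : 2 * y < k by nia.
have t2 : 2 * u < t by lia.
have tx : 2 * u * x <= t * x by rewrite leq_mul2r; apply/orP; right; lia.
have ty : (t + u) * (2 * y).+1 <= (t + u) * k by rewrite leq_mul2l k2 orbT.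
nia.
Qed.

(** The case |A| = 2, with t equal to N or N - 1. If t = N, then T <= S + 1, so N m <= E <= 4 m
    forces N = 4. *)
Lemma arith_two (N t m h E S T : nat) :
  3 < N -> t <= N -> N <= t.+1 -> 0 < m -> S <= 2 * m ->
  S <= T -> (E + 1 = S + T)%N -> t * m <= E ->
  T + t * h + (N - t) * S <= 2 * E -> 3 * E <= 2 * (N * h) + 2 -> False.
Proof.
move=> N4 tN Nt m0 S2 ST eE mE le le3.
have [et|et] : t = N \/ N = t.+1 by lia.
  subst t; rewrite subnn mul0n addn0 in le.
  have NmE : 4 * m <= N * m by rewrite leq_mul2r N4 orbT.
  have e4 : (N * m = 4 * m)%N by lia.
  have {}e4 : N = 4 by apply/eqP; rewrite -(eqn_pmul2r m0) e4.
  subst N; lia.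
subst N; rewrite (_ : t.+1 - t = 1)%N in le; last lia.
have : 3 * h <= t * h by rewrite leq_mul2r; apply/orP; right; lia.
rewrite mulSn in le3; lia.
Qed.

(** Excludes that the largest component of T, of size rho, has at most eta elements; V is the total
    size of its sums with the components of S. *)
Lemma arith_top (s t k eta rho E S T V h : nat) :
  1 < s -> 1 < t -> eta < k -> rho <= eta -> (S + eta = s.-1 * h + k)%N ->
  T <= t * rho -> rho + s * h <= V + h -> V + t.-1 * k <= E -> (E + 1 = S + T)%N -> False.
Proof.
case: s => [//|s] _; case: t => [|[|t]] // _; rewrite /= => ek re eS Tt iso VE eE.
have : t * rho <= t * k by rewrite leq_mul2l; apply/orP; right; lia.
rewrite !mulSn in iso VE Tt *; lia.
Qed.

(** If A + B missed one point only, the w - 1 full components would already exceed the bound on |S +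
    T|, as w >= 6. *)
Lemma arith_room (N w s h E : nat) : 2 < s -> 0 < h -> N = w.+1 -> 3 * s <= N + 2 ->
  1 + w.-1 * h <= E -> 3 * E <= 2 * (N * h) + 2 -> False.
Proof.
move=> s3 h0 -> sN; case: w sN => [|w] sN /=; first lia.
have : 5 * h <= w * h by rewrite leq_mul2r; apply/orP; right; lia.
rewrite !mulSn; lia.
Qed.

Section Levels.
Variable T : choiceType.
Implicit Types (C D : {fset T}).

Lemma card_fset_cond C (P : pred T) :
  #|` [fset c in C | P c]| = \sum_(c <- C) P c.
Proof.
rewrite -(@perm_size _ [seq c <- C | P c]).
  by rewrite size_filter -sum1_count big_mkcond; apply: eq_bigr => c _; case: (P c).
apply: uniq_perm; rewrite ?filter_uniq ?fset_uniq // => c.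
by rewrite mem_filter !inE andbC.
Qed.

Lemma sum_ltn k h : k <= h -> \sum_(r < h) (r < k) = k.
Proof.
move=> kh; rewrite -(big_mkord xpredT (fun r => (r < k) : nat)).
have e1 : \sum_(0 <= r < k) ((r < k) : nat) = k.
  rewrite big_nat (eq_bigr (fun=> 1)) => [|r /andP[_ ->] //].
  by rewrite -big_nat sum_nat_const_nat subn0 muln1.
have e2 : \sum_(k <= r < h) ((r < k) : nat) = 0.
  by rewrite big_nat big1 => // r /andP[]; rewrite leqNgt => /negPf ->.
by rewrite (@big_cat_nat _ _ _ k) //= e1 e2 addn0.
Qed.

Lemma sum_levels C (f : T -> nat) h : (forall c, c \in C -> f c <= h) ->
  \sum_(c <- C) f c = \sum_(r < h) #|` [fset c in C | r < f c]|.
Proof.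
move=> fh; under [in RHS]eq_bigr => r _ do rewrite card_fset_cond.
rewrite exchange_big /=; apply: eq_big_seq => c /fh fch.
by rewrite sum_ltn.
Qed.

Lemma sum_fset_const C k : \sum_(c <- C) k = #|` C| * k.
Proof. by rewrite big_const_seq iter_addn_0 count_predT mulnC. Qed.

Lemma leq_sum_fset C (f g : T -> nat) : (forall c, c \in C -> f c <= g c) ->
  \sum_(c <- C) f c <= \sum_(c <- C) g c.
Proof.
by move=> fg; rewrite big_seq [leqRHS]big_seq; apply: leq_sum => c; exact: fg.
Qed.

End Levels.

(** C splits into X + x, where f bounds g from below, and |C| - |X| points worth at least k each. *)
Lemma sum_translate_le (V : zmodType) (C X : {fset V}) x (f g : V -> nat) k :
  X :+: [fset x] `<=` C -> (forall y, y \in X -> f y <= g (y + x)%R) ->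
  (forall c, c \in C -> c \notin X :+: [fset x] -> k <= g c) ->
  \sum_(y <- X) f y + (#|` C| - #|` X|) * k <= \sum_(c <- C) g c.
Proof.
move=> XC fg kg; rewrite [leqRHS](big_fsetID _ (mem (X :+: [fset x]))) /=.
have -> : [fset y | y in C & y \in X :+: [fset x]] = [fset (y + x)%R | y in X].
  apply/fsetP=> y; rewrite !inE /=; apply/andP/imfsetP => [[_]|[u /= uX ->]].
    by rewrite mem_addfs1 => yX; exists (y - x)%R => //; rewrite subrK.
  by rewrite (fsubsetP XC) mem_addfs ?inE.
rewrite big_imfset /=; last by move=> ? ? _ _; exact: addIr.
apply: leq_add; first exact: leq_sum_fset.
have -> : [fset y | y in C & y \notin X :+: [fset x]] = C `\` (X :+: [fset x]).
  by apply/fsetP=> y; rewrite !inE andbC.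
rewrite -(card_addfs1 X x) -cardfsDS // -sum_fset_const; apply: leq_sum_fset => c.
by rewrite in_fsetD => /andP[cX cC]; exact: kg.
Qed.

(** * Counting components *)

Section Fibres.
Variables (V : zmodType) (A B : {fset V}) (h : nat).
(** These stand for the sizes of the components S_i, T_j, (S + T)_c and of S_i + T_j. [sumS] says
    that S misses fewer than |H| elements of S + H, and [iso] is the isoperimetric bound for T_j. *)
Variables (su tu eu : V -> nat) (v : V -> V -> nat).
Implicit Types (i j c z : V).

Hypotheses (gA : expanding A) (A1 : 1 < #|` A|) (B1 : 1 < #|` B|) (h0 : 0 < h).
Hypothesis suP : forall i, i \in A -> 0 < su i <= h.
Hypothesis tuP : forall j, j \in B -> 0 < tu j <= h.
Hypothesis eu_le : forall c, eu c <= h.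
Hypothesis vP : forall i j, i \in A -> j \in B ->
  [/\ su i <= v i j, tu j <= v i j, v i j <= eu (i + j)%R
    & h < su i + tu j -> h <= v i j].
Hypothesis sumE :
  (\sum_(c <- A :+: B) eu c + 1 = \sum_(i <- A) su i + \sum_(j <- B) tu j)%N.
Hypothesis sumS : #|` A| * h < \sum_(i <- A) su i + h.
Hypothesis iso : forall j, j \in B -> tu j + #|` A| * h <= \sum_(i <- A) v i j + h.
Hypothesis leST : \sum_(i <- A) su i <= \sum_(j <- B) tu j.
Hypothesis two_thirds : forall F : {fset V}, (forall x, x \in F) ->
  3 * \sum_(c <- A :+: B) eu c <= 2 * (#|` F| * h) + 2.

Local Notation S := (\sum_(i <- A) su i).
Local Notation T := (\sum_(j <- B) tu j).
Local Notation lev f C r := [fset c in C | r < f c].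

Let A0 : A != fset0. Proof. by rewrite -cardfs_gt0; apply: leq_trans A1. Qed.
Let B0 : B != fset0. Proof. by rewrite -cardfs_gt0; apply: leq_trans B1. Qed.

Lemma levP (f : V -> nat) (C : {fset V}) r c : (c \in lev f C r) = (c \in C) && (r < f c).
Proof. by rewrite !inE. Qed.

Lemma eu_ge i j : i \in A -> j \in B -> su i <= eu (i + j)%R /\ tu j <= eu (i + j)%R.
Proof. by move=> iA jB; have [h1 h2 h3 _] := vP iA jB; split; apply: leq_trans h3. Qed.

Lemma lev_sub_l r : lev su A r :+: B `<=` lev eu (A :+: B) r.
Proof.
apply/fsubsetP=> _ /addfsP[i + [j jB ->]]; rewrite !levP => /andP[iA lti].
by rewrite mem_addfs //=; apply: leq_trans lti _; case: (eu_ge iA jB).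
Qed.

Lemma lev_sub_r r : A :+: lev tu B r `<=` lev eu (A :+: B) r.
Proof.
apply/fsubsetP=> _ /addfsP[i iA [j + ->]]; rewrite !levP => /andP[jB ltj].
by rewrite mem_addfs //=; apply: leq_trans ltj _; case: (eu_ge iA jB).
Qed.

Lemma iso_sub (X : {fset V}) : X `<=` B -> X != fset0 ->
  #|` X| + #|` A| <= (#|` A :+: X|).+1 \/ A :+: X = A :+: B.
Proof.
move=> XB X0; have [zX|full] := pselect (exists z, z \notin A :+: X).
  case: zX => z; rewrite [A :+: X]addfsC => zX; left.
  exact: (expanding_isoperimetric gA A0 X0 zX).
right; apply/eqP; rewrite eqEfsubset addfsS //=; apply/fsubsetP=> z _.
by apply: contrapT => /negP zX; apply: full; exists z.
Qed.

(** Otherwise |A_r| + |B_r| <= |C_r| at each level r, and summing over r gives |S| + |T| <= |S + T|.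
    If A_r is not A, this uses A + B_r; if A_r = A, then C_r is all of A + B. *)
Lemma card_addfs_small : #|` A :+: B| < #|` A| + #|` B|.
Proof.
rewrite ltnNge; apply/negP=> cAB.
suff : S + T <= \sum_(c <- A :+: B) eu c by move: sumE; clear; lia.
rewrite (@sum_levels _ A su h) => [|i /suP/andP[] //].
rewrite (@sum_levels _ B tu h) => [|j /tuP/andP[] //].
rewrite (@sum_levels _ (A :+: B) eu h) // -big_split /=; apply: leq_sum => r _.
have := fsubset_leq_card (lev_sub_l r); have := fsubset_leq_card (lev_sub_r r).
set Ar := lev su A r; set Br := lev tu B r; set Cr := lev eu _ r => cr cl.
have ArA : Ar `<=` A by apply/fsubsetP=> i; rewrite levP => /andP[].
have BrB : Br `<=` B by apply/fsubsetP=> i; rewrite levP => /andP[].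
have [Br0|Br0] := eqVneq Br fset0.
  by rewrite Br0 cardfs0 addn0; apply: leq_trans cl; exact: leq_card_addfs.
have [ArE|ArE] := eqVneq Ar A.
  apply: leq_trans cl; rewrite ArE; apply: leq_trans cAB.
  by rewrite leq_add2l fsubset_leq_card.
have ltA : #|` Ar| < #|` A| by apply: fproper_ltn_card; rewrite fproperEneq ArE.
have := fsubset_leq_card BrB.
by have [?|e] := iso_sub BrB Br0; [|rewrite e in cr]; card_lia.
Qed.

Lemma card_full (F : {fset V}) : (forall x, x \in F) -> 3 * #|` A| <= #|` F| + 2.
Proof.
move=> fF; have := two_thirds fF.
suff : 3 * (#|` A| * h) < #|` F| * h + 3 * h.
  by rewrite mulnA -mulnDl ltn_pmul2r //; card_lia.
move: sumE sumS leST (two_thirds fF).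
move: (\sum_(c <- A :+: B) eu c) S T (#|` A| * h) (#|` F| * h); clear; lia.
Qed.

Lemma sumS_split i : i \in A ->
  exists2 R, S = (su i + R)%N & forall m, (forall k, k \in A -> k != i -> su k <= m) ->
     R <= #|` A|.-1 * m.
Proof.
move=> iA; exists (\sum_(k <- A `\ i) su k); first by rewrite (big_fsetD1 i).
move=> m mP; have -> : #|` A|.-1 = #|` A `\ i| by rewrite (cardfsD1 i) iA.
rewrite -sum_fset_const; apply: leq_sum_fset => k; rewrite !inE => /andP[ki kA].
exact: mP.
Qed.

Lemma eu_ge_min (k : nat) c : (forall i, i \in A -> k <= su i) ->
  c \in A :+: B -> k <= eu c.
Proof.
move=> kmin /addfsP[i iA [j jB ->]]; apply: leq_trans (kmin i iA) _.
by have [] := eu_ge iA jB.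
Qed.

(** If A + B were Q, |S + T| would be too large: over im + B the components have at least the
    maximal size in S, elsewhere at least the minimal one. *)
Lemma addfs_not_full : exists z, z \notin A :+: B.
Proof.
apply: contrapT => nfull.
have full x : x \in A :+: B by apply: contrapT => /negP nx; apply: nfull; exists x.
have sub (X : {fset V}) : X `<=` A :+: B by apply/fsubsetP=> x _.
have [i0 i0A mini] := fset_argmin su A0; have [im imA maxi] := fset_argmax su A0.
have /andP[m0 mh] := suP imA.
have tN := fsubset_leq_card (sub B).
have small := card_addfs_small; have cA := card_full full.
have [R eS leR] := sumS_split i0A.
have {}leR : R <= #|` A|.-1 * su im by apply: leR => k kA _; exact: maxi.
have := @sum_translate_le _ (A :+: B) B im (fun=> su im) eu (su i0) (sub _).
rewrite sum_fset_const => leE.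
have {}leE : #|` B| * su im + (#|` A :+: B| - #|` B|) * su i0 <= \sum_(c <- A :+: B) eu c.
  apply: leE => [j jB|c cAB _]; last exact: eu_ge_min mini cAB.
  by rewrite addrC; case: (eu_ge imA jB).
have [A3|A2] := ltnP 2 #|` A|.
  apply: (arith_large A3 small tN cA (maxi _ i0A) mh leR _ leE (two_thirds full)).
  by rewrite -eS.
have [i1 [i2 [i1A i2A i12]]] := cardfs_gt1P _ A1.
have eA : A = [fset i1; i2].
  by apply/eqP; rewrite eq_sym eqEfcard fsubUset !fsub1set i1A i2A cardfs2 i12.
have sumA (f : V -> nat) : (\sum_(i <- A) f i = f i1 + f i2)%N.
  rewrite eA big_fsetU1 /= ?big_seq_fset1 //.
  by rewrite inE.
(* Off the translate i + B, each element of A + B comes from the other element of A. Adding both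
   estimates and [iso] gives the hypothesis of [arith_two]. *)
have side i k : i \in A -> (forall j, j \in A -> j != i -> k <= su j) ->
    \sum_(j <- B) v i j + (#|` A :+: B| - #|` B|) * k <= \sum_(c <- A :+: B) eu c.
  move=> iA kP; apply: (@sum_translate_le _ _ _ i) => // [j jB|c].
    by rewrite addrC; case: (vP iA jB).
  case/addfsP=> j jA [b bB ->] nB.
  have [/kP - /(_ jA) le|e] := boolP (j != i).
    by apply: leq_trans le _; case: (eu_ge jA bB).
  by move: nB; rewrite (eqP (negbNE e)) addrC mem_addfs ?inE.
have s1 := side i1 (su i2) i1A; have s2 := side i2 (su i1) i2A.
have {}s1 := s1 _; have {}s2 := s2 _.
apply: (@arith_two #|` A :+: B| #|` B| (su im) h (\sum_(c <- A :+: B) eu c) S T) => //.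
- card_lia.
- card_lia.
- by rewrite sumA mul2n -addnn leq_add ?maxi.
- by apply: leq_trans leE; exact: leq_addr.
- have : T + #|` B| * h <= \sum_(j <- B) v i1 j + \sum_(j <- B) v i2 j.
    rewrite -sum_fset_const -!big_split /=; apply: leq_sum_fset => j jB.
    have := iso jB; rewrite sumA eA cardfs2 i12; clear; lia.
  have {}s1 : \sum_(j <- B) v i1 j + (#|` A :+: B| - #|` B|) * su i2 <= \sum_(c <- A :+: B) eu c.
    by apply: s1 => j; rewrite eA !inE => /orP[/eqP ->|/eqP -> //]; rewrite eqxx.
  have {}s2 : \sum_(j <- B) v i2 j + (#|` A :+: B| - #|` B|) * su i1 <= \sum_(c <- A :+: B) eu c.
    by apply: s2 => j; rewrite eA !inE => /orP[/eqP -> //|/eqP ->]; rewrite eqxx.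
  move: s1 s2; rewrite sumA mulnDr; clear.
  move: (_ * su i1) (_ * su i2) (\sum_(j <- B) v i1 j) (\sum_(j <- B) v i2 j) (_ * h).
  move=> *; lia.
- exact: two_thirds.
Qed.

Lemma card_addfs_eq : (#|` A :+: B| + 1 = #|` A| + #|` B|)%N.
Proof.
have [z] := addfs_not_full; have := card_addfs_small.
by rewrite [A :+: B]addfsC => lt /(expanding_isoperimetric gA A0 B0); card_lia.
Qed.

(* i0 is the index of the smallest component of S, and eta is the number of
   holes of the other components. *)
Lemma other_fibres_full : exists2 i0, i0 \in A &
  forall i j, i \in A -> i != i0 -> j \in B -> h <= eu (i + j)%R.
Proof.
have [i0 i0A mini] := fset_argmin su A0; exists i0 => //.
have /andP[k0 kh] := suP i0A; set k := su i0 in k0 kh mini.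
have [R eS leR] := sumS_split i0A.
have {}leR : R <= #|` A|.-1 * h by apply: leR => i /suP/andP[].
have [eta eeta] : exists eta, (S + eta = #|` A|.-1 * h + k)%N.
  by exists (#|` A|.-1 * h + k - S); rewrite subnKC // eS addnC leq_add2r.
(* S has fewer than h holes in total, and h - k of them are in the smallest component. *)
have ek : eta < k.
  move: sumS eeta; rewrite -{1}(prednK (ltnW A1)) mulSn; clear; lia.
have hole i : i \in A -> i != i0 -> h <= su i + eta.
  move=> iA ii0; move: eeta.
  rewrite (big_fsetD1 i0) //= (big_fsetD1 i) /=; last by rewrite !inE ii0.
  have : \sum_(l <- A `\ i0 `\ i) su l <= #|` A `\ i0 `\ i| * h.
    by rewrite -sum_fset_const; apply: leq_sum_fset => l; rewrite !inE => /and3P[_ _ /suP/andP[]].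
  have -> : #|` A|.-1 = (#|` A `\ i0 `\ i|).+1.
    by rewrite (cardfsD1 i0) i0A (cardfsD1 i (A `\ i0)) !inE ii0 iA.
  rewrite mulSn -/k; set X := (X in (k + (su i + X) + eta)%N) => h1.
  have {}h1 : X <= #|` A `\ i0 `\ i| * h := h1.
  by move: X (_ * h) h1; clear => *; lia.
have kle c : c \in A :+: B -> k <= eu c by exact: eu_ge_min mini.
have cAB := card_addfs_eq.
have [jm jmB maxj] := fset_argmax tu B0.
have rho : eta < tu jm.
  rewrite ltnNge; apply/negP=> re.
  apply: (arith_top A1 B1 ek re eeta _ (iso jmB) _ sumE).
    by rewrite -sum_fset_const; exact: leq_sum_fset.
  have -> : #|` B|.-1 = #|` A :+: B| - #|` A| by move: cAB B1; card_lia.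
  apply: (@sum_translate_le _ _ _ jm) => [|i iA|c cC _]; last exact: kle.
    by rewrite addfsS // fsub1set.
  by have [_ _ ->] := vP iA jmB.
(* Below k the level set is all of A + B. Above it the isoperimetric bound for B_r applies; if B_r
   is empty, the components over i + jm with i <> i0 are full by [rho]. *)
have lev_ge r : r < h ->
    #|` A|.-1 + (if r < k then #|` B| else #|` lev tu B r|) <= #|` lev eu (A :+: B) r|.
  move=> rh; case: ltnP => [rk|kr].
    have -> : lev eu (A :+: B) r = A :+: B.
      apply/fsetP=> c; rewrite levP; apply: andb_idr => /kle; exact: leq_trans.
    move: cAB A1; card_lia.
  have := fsubset_leq_card (lev_sub_r r).
  have BrB : lev tu B r `<=` B by apply/fsubsetP=> i; rewrite levP => /andP[].
  have [->|Br0] := eqVneq (lev tu B r) fset0; last first.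
    have := fsubset_leq_card BrB.
    by case: (iso_sub BrB Br0) => [|->]; move: cAB A1; card_lia.
  move=> _; rewrite cardfs0 addn0.
  have -> : #|` A|.-1 = #|` (A `\ i0) :+: [fset jm]|.
    by rewrite card_addfs1 (cardfsD1 i0) i0A.
  apply: fsubset_leq_card; apply/fsubsetP=> _ /addfsP[i + [_ /fset1P -> ->]].
  rewrite in_fsetD1 levP => /andP[ii0 iA]; rewrite mem_addfs //=.
  apply: leq_trans rh _; have [_ _ h3 h4] := vP iA jmB; apply: leq_trans h3.
  by apply: h4; apply: leq_ltn_trans (hole i iA ii0) _; rewrite ltn_add2l.
(* If T_j has at most eta elements, j is missing from B_r at the levels between its size and k. This
   gains k - eta in the sum of [lev_ge], and yields |S + T| >= |S| + |T|. *)
have tu_gt j : j \in B -> eta < tu j.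
  move=> jB; rewrite ltnNge; apply/negP=> je; have /andP[_ tjh] := tuP jB.
  have : \sum_(r < h) (#|` A|.-1 + (if r < k then #|` B| else #|` lev tu B r|))
         <= \sum_(c <- A :+: B) eu c.
    by rewrite (@sum_levels _ (A :+: B) eu h) //; apply: leq_sum => r _; exact: lev_ge.
  have : T + k <= \sum_(r < h) (if r < k then #|` B| else #|` lev tu B r|) + tu j.
    rewrite (@sum_levels _ B tu h) => [|l /tuP/andP[] //].
    rewrite -[in leqLHS](sum_ltn kh) -[in leqRHS](sum_ltn tjh) -!big_split /=.
    apply: leq_sum => r _.
    have BrB : lev tu B r `<=` B by apply/fsubsetP=> i; rewrite levP => /andP[].
    case: (ltnP r k) => rk; last by rewrite addn0 leq_addr.
    case: (ltnP r (tu j)) => rj; first by rewrite leq_add2r fsubset_leq_card.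
    rewrite addn0 addn1; apply: fproper_ltn_card.
    rewrite fproperEneq BrB andbT; apply/eqP=> e.
    by move: jB; rewrite -e levP ltnNge rj andbF.
  rewrite big_split /= sum_nat_const card_ord mulnC => le1 le2.
  have ar (t e s' t' E X p q : nat) : t <= e -> (s' + e = p + q)%N ->
    (E + 1 = s' + t')%N -> t' + q <= X + t -> p + X <= E -> False by clear; lia.
  exact: ar je eeta sumE le1 le2.
move=> i j iA ii0 jB; have [_ _ h3 h4] := vP iA jB; apply: leq_trans h3.
by apply: h4; apply: leq_ltn_trans (hole i iA ii0) _; rewrite ltn_add2l tu_gt.
Qed.

Lemma critical_fibres : exists i0 j0, [/\ i0 \in A, j0 \in B &
    forall i j, i \in A -> j \in B -> eu (i + j)%R < h -> i = i0 /\ j = j0] /\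
  [/\ #|` A :+: B| < #|` A| + #|` B|, exists z, z \notin A :+: B
  & 2 < #|` A| -> exists y z, [/\ y != z, y \notin A :+: B & z \notin A :+: B]].
Proof.
have [i0 i0A full] := other_fibres_full; have [z zAB] := addfs_not_full.
have := expanding_unique_expression gA A1 B0 card_addfs_small zAB i0A.
set Y := [fset _ in _ | _] => Y1.
have [j0 j0B YP] : exists2 j0, j0 \in B & forall j, j \in Y -> j = j0.
  have [Ye|/fset0Pn[j0 j0Y]] := eqVneq Y fset0.
    by have /fset0Pn[j0 j0B] := B0; exists j0 => // j; rewrite Ye inE.
  exists j0; first by move: j0Y; rewrite !inE => /andP[].
  move=> j jY; apply: contrapT => /eqP jj0.
  by move: Y1; rewrite leqNgt => /negP; apply; apply/cardfs_gt1P; exists j, j0.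
have uniq i j : i \in A -> j \in B -> eu (i + j)%R < h -> i = i0 /\ j = j0.
  move=> iA jB lt.
  (* Every expression of a component that is not full uses i0, so j belongs to Y, which has at most
     one element. *)
  have eq_i0 i' j' : i' \in A -> j' \in B -> (i' + j' = i + j)%R -> i' = i0.
    move=> i'A j'B e; apply: contrapT => /eqP ne.
    by move: lt; rewrite -e ltnNge full.
  have ei := eq_i0 i j iA jB erefl; split=> //; apply: YP; rewrite !inE jB /=.
  apply/negP=> /addfsP[i' + [j' j'B e]]; rewrite !inE => /andP[/eqP ne i'A].
  by apply: ne; apply: (eq_i0 i' j') => //; rewrite -e ei.
exists i0, j0; split; split=> //; first exact: card_addfs_small.
  by exists z.
move=> A2; apply: contrapT => none.
have fF x : x \in z |` (A :+: B).
  rewrite in_fset1U; apply: contrapT => /negP; rewrite negb_or => /andP[xz xAB].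
  by apply: none; exists x, z.
have := card_full fF; have := two_thirds fF.
rewrite cardfsU1 zAB add1n => t23 cF.
have e0AB := mem_addfs i0A j0B.
apply: (arith_room A2 h0 erefl cF _ t23).
rewrite (big_fsetD1 (i0 + j0)%R) //=; apply: leq_add.
  by have [le _] := eu_ge i0A j0B; apply: leq_trans le; case/andP: (suP i0A).
have -> : #|` A :+: B|.-1 = #|` (A :+: B) `\ (i0 + j0)%R|.
  by rewrite (cardfsD1 (i0 + j0)%R) e0AB.
rewrite -sum_fset_const; apply: leq_sum_fset => c.
rewrite in_fsetD1 => /andP[/eqP ne /addfsP[i iA [j jB ec]]].
rewrite leqNgt; apply/negP; rewrite ec => /(uniq _ _ iA jB)[ei ej].
by apply: ne; rewrite ec ei ej.
Qed.

End Fibres.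

(** * Passing to the quotient *)

Section QuotientLevel.
Variables (G Q : zmodType) (f : {additive G -> Q}) (H : {fset G}).
Hypothesis gH : fgroup H.
Hypothesis kerf : forall x y, (f x == f y) = ((x - y)%R \in H).
Hypothesis surjf : forall q, exists x, f x = q.
Implicit Types (X Y Z : {fset G}) (x y z : G) (i j c q : Q).

Local Notation fib X i := [fset x in X | f x == i].

Lemma fibP X i x : (x \in fib X i) = (x \in X) && (f x == i).
Proof. by rewrite !inE. Qed.

Lemma mem_fimage X x : x \in X -> f x \in [fset f x | x in X].
Proof. by move=> xX; apply/imfsetP; exists x. Qed.

Lemma fib_gt0 X i : i \in [fset f x | x in X] -> 0 < #|` fib X i|.
Proof.
case/imfsetP=> x /= xX ->; rewrite cardfs_gt0; apply/fset0Pn; exists x.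
by rewrite fibP xX eqxx.
Qed.

Lemma fib_coset X x : fib X (f x) `<=` [fset x] :+: H.
Proof. by apply/fsubsetP=> y; rewrite fibP mem_coset kerf => /andP[]. Qed.

Lemma fib_le X i : #|` fib X i| <= #|` H|.
Proof.
by have [x <-] := surjf i; rewrite -(card_coset H x) fsubset_leq_card // fib_coset.
Qed.

Lemma fib_full X x : #|` H| <= #|` fib X (f x)| -> x \in X.
Proof.
move=> le; have : fib X (f x) == [fset x] :+: H.
  by rewrite eqEfcard fib_coset card_coset.
move/eqP/fsetP/(_ x); rewrite coset_id // fibP => /andP[] //.
Qed.

Lemma card_fibres X (C : {fset Q}) : (forall x, x \in X -> f x \in C) ->
  #|` X| = \sum_(c <- C) #|` fib X c|.
Proof.
move=> XC; under eq_bigr => c _ do rewrite card_fset_cond.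
rewrite exchange_big /= card_fset_sum1; apply: eq_big_seq => x /XC fC.
rewrite (big_fsetD1 (f x)) //= eqxx big_seq big1 ?addn0 // => c.
by rewrite !inE eq_sym => /andP[/negPf ->].
Qed.

Lemma card_cover (I : choiceType) (A : {fset I}) Z (W : I -> {fset G}) :
  (forall z, z \in Z -> exists2 i, i \in A & z \in W i) ->
  #|` Z| <= \sum_(i <- A) #|` W i|.
Proof.
move=> cov; apply: leq_trans (_ : \sum_(i <- A) #|` [fset z in Z | z \in W i]| <= _).
  under eq_bigr => i _ do rewrite card_fset_cond.
  rewrite exchange_big /= card_fset_sum1; apply: leq_sum_fset => z /cov[i iA zW].
  by rewrite (big_fsetD1 i) //= zW.
apply: leq_sum_fset => i _; apply: fsubset_leq_card; apply/fsubsetP=> z.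
by rewrite !inE => /andP[].
Qed.

Lemma fimage_addfs X Y :
  [fset f x | x in X :+: Y] = [fset f x | x in X] :+: [fset f x | x in Y].
Proof.
apply/fsetP=> q; apply/imfsetP/addfsP => [[_ /addfsP[x xX [y yY ->]] ->]|].
  by exists (f x); [exact: mem_fimage | exists (f y); [exact: mem_fimage | rewrite raddfD]].
case=> _ /imfsetP[x /= xX ->] [_ /imfsetP[y /= yY ->] ->].
by exists (x + y)%R; [exact: mem_addfs | rewrite raddfD].
Qed.

Lemma mem_fgroup_kernel x : (x \in H) = (f x == 0%R).
Proof. by rewrite -[in RHS](raddf0 f) kerf subr0. Qed.

Lemma mem_addfs_kernel X x : (x \in X :+: H) = (f x \in [fset f x | x in X]).
Proof.
apply/idP/imfsetP => [/addfsP[y yX [k kH ->]]|[y /= yX /eqP]].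
  exists y => //; apply/eqP; rewrite kerf addrC addKr //.
by rewrite kerf -mem_coset; exact: mem_coset_addfs.
Qed.

Lemma card_addfs_kernel X : #|` X :+: H| = (#|` [fset f x | x in X]| * #|` H|)%N.
Proof.
rewrite (@card_fibres _ [fset f x | x in X]) => [|x]; last by rewrite mem_addfs_kernel.
rewrite -sum_fset_const; apply: eq_big_seq => c /imfsetP[x /= xX ->].
rewrite -(card_coset H x); congr #|` _|; apply/fsetP=> y.
rewrite fibP mem_coset -kerf mem_addfs_kernel andb_idl // => /eqP ->.
exact: mem_fimage.
Qed.

Lemma preimage_fset (C : {fset Q}) : exists2 X : {fset G},
  (forall x, (x \in X) = (f x \in C)) & #|` X| = (#|` C| * #|` H|)%N.
Proof.
pose g q := projT1 (cid (surjf q)).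
have gK q : f (g q) = q := projT2 (cid (surjf q)).
have e : [fset f x | x in [fset g q | q in C]] = C.
  apply/fsetP=> q; apply/imfsetP/idP => [[_ /imfsetP[q' /= q'C ->] ->]|qC].
    by rewrite gK.
  by exists (g q); rewrite ?gK //; apply/imfsetP; exists q.
exists ([fset g q | q in C] :+: H); last by rewrite card_addfs_kernel e.
by move=> x; rewrite mem_addfs_kernel e.
Qed.

(** Pigeonhole: for z in x + y + H, both X and z - Y lie in x + H and are too large to be
    disjoint. *)
Lemma addfs_large X Y x y : X `<=` [fset x] :+: H -> Y `<=` [fset y] :+: H ->
  #|` H| < #|` X| + #|` Y| -> [fset (x + y)%R] :+: H `<=` X :+: Y.
Proof.
move=> /fsubsetP XH /fsubsetP YH lt; apply/fsubsetP=> z zH.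
pose Y' := [fset (z - u)%R | u in Y].
have cY' : #|` Y'| = #|` Y| by rewrite card_imfset // => u w /addrI/oppr_inj.
have Y'H : Y' `<=` [fset x] :+: H.
  apply/fsubsetP=> _ /imfsetP[u /= /YH uH ->]; move: uH zH; rewrite !mem_coset.
  move=> uH zH; have := gH.2 _ _ zH uH; congr (_ \in H).
  by rewrite opprD opprB addrA -[(_ + _ + y)%R]addrA subrK addrAC.
have /fset0Pn[u /fsetIP[uX /imfsetP[w /= wY eu]]] : X `&` Y' != fset0.
  rewrite -cardfs_gt0; have := cardfsUI X Y'; rewrite cY'.
  have : X `|` Y' `<=` [fset x] :+: H by rewrite fsubUset Y'H andbT; apply/fsubsetP.
  move/fsubset_leq_card; rewrite card_coset; move: lt; card_lia.
by rewrite -[z](subrK w) -eu mem_addfs.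
Qed.

Variables (S T : {fset G}) (z0 : G).
Hypotheses (S0 : 0%R \in S) (z0ST : z0 \notin S :+: T).
Hypothesis cST : (#|` S :+: T| + 1 = #|` S| + #|` T|)%N.
Hypothesis leST : #|` S| <= #|` T|.
Hypothesis two_thirds : forall F : {fset G}, (forall x, x \in F) ->
  3 * #|` S :+: T| <= 2 * #|` F| + 2.
(** [kappaS] expresses that |H + S| - |H| is the minimum kappa_1(S), and [maxH] that no larger
    subgroup attains it. *)
Hypothesis kappaS : forall X, X != fset0 -> (exists z, z \notin X :+: S) ->
  #|` X| + #|` S :+: H| <= #|` X :+: S| + #|` H|.
Hypothesis maxH : forall K, fgroup K -> #|` H| < #|` K| ->
  (exists z, z \notin K :+: S) -> #|` K| + #|` S :+: H| < #|` K :+: S| + #|` H|.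
Hypothesis A1 : 1 < #|` [fset f x | x in S]|.

Local Notation A := [fset f x | x in S].
Local Notation B := [fset f x | x in T].
Local Notation h := #|` H|.

Lemma T_neq0 : T != fset0.
Proof.
rewrite -cardfs_gt0; apply: leq_trans leST; rewrite cardfs_gt0.
by apply/fset0Pn; exists 0%R.
Qed.

(** The isoperimetric bound for X = T, with |S + T| = |S| + |T| - 1. *)
Lemma holes_S : #|` A| * h < #|` S| + h.
Proof.
have := kappaS T_neq0; rewrite [T :+: S]addfsC card_addfs_kernel => /(_ _).
have ex : exists z, z \notin S :+: T by exists z0.
move=> /(_ ex); move: cST; clear; lia.
Qed.

Lemma card_quotient_full (F : {fset Q}) : (forall q, q \in F) -> 3 * #|` A| <= #|` F| + 2.
Proof.
move=> fF; have [F' F'P cF'] := preimage_fset F.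
have fF' x : x \in F' by rewrite F'P.
have h0 := fgroup_gt0 gH.
suff : 3 * (#|` A| * h) < #|` F| * h + 3 * h.
  by rewrite mulnA -mulnDl ltn_pmul2r //; card_lia.
have := two_thirds fF'; rewrite cF'; have := holes_S; move: cST leST.
move: (_ * h) (_ * h); clear; lia.
Qed.

(** If K + A is not Q, the preimage of K is a subgroup larger than H, and [maxH] divided by |H| is
    the claim. If K + A = Q, it follows from |Q| >= 2|K| >= 4 and 3|A| <= |Q| + 2. *)
Lemma expanding_quotient : expanding A.
Proof.
move=> K gK K1 pK; have h0 := fgroup_gt0 gH.
have [[q qKA]|full] := pselect (exists q, q \notin K :+: A); last first.
  have fF q : q \in K :+: A by apply: contrapT => /negP nq; apply: full; exists q.
  have := card_quotient_full fF; have [x xK] := pK.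
  have : ([fset x] :+: K) `|` K `<=` K :+: A by apply/fsubsetP.
  move/fsubset_leq_card; have := cardfsUI ([fset x] :+: K) K.
  have -> : ([fset x] :+: K) `&` K = fset0.
    have := coset_disjoint (x := x) (y := 0%R) gK.
    by rewrite subr0 [[fset 0%R] :+: K]addfsC addfs0 => /(_ xK)/eqP.
  rewrite cardfs0 card_coset [A :+: K]addfsC; move: A1; card_lia.
have [K' K'P cK'] := preimage_fset K.
have gK' : fgroup K'.
  split; first by rewrite K'P raddf0; case: gK.
  by move=> x y; rewrite !K'P raddfB; case: gK => _; apply.
have eK' : [fset f x | x in K'] = K.
  apply/fsetP=> k; apply/imfsetP/idP => [[x /= + ->]|kK]; first by rewrite K'P.
  by have [x ex] := surjf k; exists x; rewrite /= ?K'P ex.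
have eKS : K' :+: S :+: H = K' :+: S.
  have K'H : K' :+: H = K'.
    by apply/fsetP=> x; rewrite mem_addfs_kernel eK' K'P.
  by rewrite addfsAC K'H.
have := maxH gK' _ _; rewrite cK' -eKS !card_addfs_kernel fimage_addfs eK'.
rewrite ltn_Pmull // => /(_ isT) lt.
have {}lt : #|` K| * h + #|` A| * h < #|` K :+: A| * h + h.
  apply: lt; have [x ex] := surjf q; exists x; apply: contra qKA => xKS.
  by rewrite -ex -eK' -fimage_addfs mem_fimage // -eKS.
move: lt; rewrite -mulnDl -[X in _ < _ + X]mul1n -mulnDl ltn_pmul2r // addfsC; card_lia.
Qed.

Lemma card_T : #|` T| = \sum_(j <- B) #|` fib T j|.
Proof. by apply: card_fibres => x; exact: mem_fimage. Qed.

Lemma card_S : #|` S| = \sum_(i <- A) #|` fib S i|.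
Proof. by apply: card_fibres => x; exact: mem_fimage. Qed.

Lemma B1 : 1 < #|` B|.
Proof.
have h0 := fgroup_gt0 gH; rewrite -(ltn_pmul2r h0) mul1n.
have : #|` T| <= #|` B| * h.
  by rewrite card_T -sum_fset_const; apply: leq_sum_fset => j _; exact: fib_le.
have : 2 * h <= #|` A| * h by rewrite leq_mul2r A1 orbT.
have := holes_S; move: leST; move: (_ * h) (#|` B| * h); clear; lia.
Qed.

Lemma quotient_fibres : exists i0 j0, [/\ i0 \in A, j0 \in B &
    forall i j, i \in A -> j \in B -> #|` fib (S :+: T) (i + j)%R| < h ->
      i = i0 /\ j = j0] /\
  [/\ #|` A :+: B| < #|` A| + #|` B|, exists q, q \notin A :+: B
  & 2 < #|` A| -> exists p q, [/\ p != q, p \notin A :+: B & q \notin A :+: B]].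
Proof.
apply: (@critical_fibres _ A B h (fun i => #|` fib S i|) (fun j => #|` fib T j|)
   (fun c => #|` fib (S :+: T) c|) (fun i j => #|` fib S i :+: fib T j|)).
- exact: expanding_quotient.
- exact: A1.
- exact: B1.
- exact: fgroup_gt0.
- by move=> i iA; rewrite fib_gt0 // fib_le.
- by move=> i iA; rewrite fib_gt0 // fib_le.
- by move=> c; exact: fib_le.
- move=> i j iA jB; have si := fib_gt0 iA; have tj := fib_gt0 jB; split.
  + by rewrite leq_card_addfs // -cardfs_gt0.
  + by rewrite addfsC leq_card_addfs // -cardfs_gt0.
  + apply: fsubset_leq_card; apply/fsubsetP=> _ /addfsP[x + [y + ->]].
    rewrite !fibP => /andP[xS /eqP <-] /andP[yT /eqP <-].
    by rewrite mem_addfs //= raddfD.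
  + move=> lt; have [x ex] := surjf i; have [y ey] := surjf j.
    rewrite -ex -ey in lt *; rewrite -(card_coset H (x + y)%R).
    by apply: fsubset_leq_card; apply: addfs_large lt; exact: fib_coset.
- rewrite -card_S -card_T -cST -card_fibres // => x xST.
  by rewrite -fimage_addfs mem_fimage.
- by rewrite -card_S; exact: holes_S.
- move=> j jB; have tj := fib_gt0 jB.
  have TjT : fib T j `<=` T by apply/fsubsetP=> y; rewrite fibP => /andP[].
  (* The sum T_j + S is covered by the sets S_i + T_j, which turns this bound into [iso]. *)
  have := @kappaS (fib T j); rewrite -cardfs_gt0 => /(_ tj) k.
  rewrite -card_addfs_kernel; apply: leq_trans (k _) _.
    exists z0; apply: contra z0ST; rewrite [S :+: T]addfsC.
    by apply/fsubsetP/addfsS.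
  rewrite leq_add2r; apply: card_cover => _ /addfsP[y yT [x xS ->]].
  exists (f x); first exact: mem_fimage.
  by rewrite addrC mem_addfs // fibP xS eqxx.
- by rewrite -card_S -card_T.
- move=> F fF; have [F' F'P cF'] := preimage_fset F.
  have := @two_thirds F'; rewrite cF' -card_fibres => [|x xST].
    by apply=> x; rewrite F'P.
  by rewrite -fimage_addfs mem_fimage.
Qed.

(** If |A| = 2, then A = {0, d} is a progression at once; otherwise B is a 2-fragment of A. Either
    way B inherits the difference of A. *)
Lemma quotient_progressions : exists d, fprogression d A /\ fprogression d B.
Proof.
have [i0 [j0 [[i0A j0B _] [small [q qAB] room]]]] := quotient_fibres.
have gA := expanding_quotient.
have A0 : 0%R \in A by apply/imfsetP; exists 0%R; rewrite ?raddf0.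
have B0 : B != fset0 by apply/fset0Pn; exists j0.
suff [d d0 Ad] : exists2 d, d != 0%R & fprogression d A.
  by exists d; split=> //; exact: (expanding_progression gA A0 A1 B0 small qAB d0 Ad).
have [A2|A2] := ltnP 2 #|` A|.
  apply: (@expanding_vosper _ A (q - j0)%R) => //.
    by apply: contra qAB => qA; rewrite -[q](subrK j0) mem_addfs.
  have [y [z [yz yAB zAB]]] := room A2.
  exists B; split; first exact: B1; rewrite [B :+: A]addfsC 1?addnC //.
  by exists y, z.
have [d dA d0] : exists2 d, d \in A & d != 0%R.
  have [x [y [xA yA xy]]] := cardfs_gt1P _ A1.
  have [ex|] := eqVneq x 0%R; last by exists x.
  by exists y => //; rewrite -ex eq_sym.
have eA : A = [fset 0%R; d].
  apply/eqP; rewrite eq_sym eqEfcard fsubUset !fsub1set A0 dA.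
  by rewrite cardfs2 eq_sym d0.
exists d => //; exists 0%R, 1 => x; rewrite eA !inE.
split=> [/orP[]/eqP ->|[[|[|i]] //]].
- by exists 0; rewrite // mulr0n addr0.
- by exists 1; rewrite // mulr1n add0r.
- by move=> _ ->; rewrite mulr0n addr0 eqxx.
- by move=> _ ->; rewrite mulr1n add0r eqxx orbT.
Qed.

Hypothesis stabST : #|` stab (S :+: T)| <= 1.

(* Filling the components of S and T other than those over i0 and j0 does not
   change S + T, which is aperiodic, so they were already full by Kneser. *)
Lemma quotient_quasi_periodic : exists i0 j0,
  (forall x k, x \in S -> f x != i0 -> k \in H -> (x + k)%R \in S) /\
  (forall y k, y \in T -> f y != j0 -> k \in H -> (y + k)%R \in T).
Proof.
have [i0 [j0 [[_ _ uniq] _]]] := quotient_fibres; exists i0, j0.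
pose S' := [fset x in S :+: H | (f x == i0) ==> (x \in S)].
pose T' := [fset y in T :+: H | (f y == j0) ==> (y \in T)].
have S'P x : (x \in S') = (f x \in A) && ((f x == i0) ==> (x \in S)).
  by rewrite -mem_addfs_kernel !inE.
have T'P y : (y \in T') = (f y \in B) && ((f y == j0) ==> (y \in T)).
  by rewrite -mem_addfs_kernel !inE.
have SS' : S `<=` S'.
  by apply/fsubsetP=> x xS; rewrite S'P mem_fimage //= xS implybT.
have TT' : T `<=` T'.
  by apply/fsubsetP=> x xT; rewrite T'P mem_fimage //= xT implybT.
have eST : S' :+: T' = S :+: T.
  apply/eqP; rewrite eqEfsubset [X in _ && X]addfsS // andbT.
  apply/fsubsetP=> _ /addfsP[x + [y + ->]]; rewrite S'P T'P.
  move=> /andP[fxA /implyP xS] /andP[fyB /implyP yT].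
  have [lt|] := ltnP #|` fib (S :+: T) (f x + f y)%R| h; last first.
    by rewrite -raddfD; exact: fib_full.
  have [/eqP ex /eqP ey] := uniq _ _ fxA fyB lt.
  by rewrite mem_addfs ?xS ?yT.
have Sn0 : S != fset0 by apply/fset0Pn; exists 0%R.
have S'0 : S' != fset0 by apply/fset0Pn; exists 0%R; exact: (fsubsetP SS').
have T'0 : T' != fset0.
  by have /fset0Pn[y yT] := T_neq0; apply/fset0Pn; exists y; exact: (fsubsetP TT').
have ST0 : S :+: T != fset0 by rewrite addfs_neq0 Sn0 T_neq0.
have := kneser S'0 T'0; have cK := stabST; rewrite eST; set K := stab _ in cK *.
have gK : fgroup K := fgroup_stab ST0.
have := fsubset_leq_card (sub_addfs_fgroup S' gK).
have := fsubset_leq_card (sub_addfs_fgroup T' gK) => cT' cS' kn.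
have eS : S' = S.
  apply/eqP; rewrite eq_sym eqEfcard SS' /=; have := fsubset_leq_card TT'.
  by move: cST; card_lia.
have eT : T' = T.
  apply/eqP; rewrite eq_sym eqEfcard TT' /=; have := fsubset_leq_card SS'.
  by move: cST; card_lia.
have fk k : k \in H -> f k = 0%R by rewrite mem_fgroup_kernel => /eqP.
split=> x k xX fx kH.
  by rewrite -eS S'P raddfD (fk k kH) addr0 mem_fimage //= (negPf fx).
by rewrite -eT T'P raddfD (fk k kH) addr0 mem_fimage //= (negPf fx).
Qed.

End QuotientLevel.

(** * Classical sets *)

Section ClassicalSets.
Variable G : zmodType.
Implicit Types (X Y F K : {fset G}) (x y z : G).

Lemma set_of_fset (A : set G) : finite_set A -> exists X, A = [set` X]%classic.
Proof. by move=> fA; exists (fset_set A); rewrite fset_setK. Qed.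

Lemma ecard_fset X : ecard [set` X]%classic = (#|` X|%:Z)%:E%E.
Proof. by rewrite /ecard asboolT ?set_fsetK. Qed.

Lemma ecard_gt0P (A : set G) : (1 <= ecard A)%E <-> exists x, A x.
Proof.
rewrite /ecard; case: asboolP => fA; last first.
  split=> // _; apply: contrapT => nA; apply: fA.
  by have -> : A = set0 by apply/seteqP; split => // x Ax; apply: nA; exists x.
rewrite lee_fin; have [X eA] := set_of_fset fA; rewrite eA set_fsetK.
rewrite lez_nat cardfs_gt0; split=> [/fset0Pn|[x xX]]; first by case=> x xX; exists x.
by apply/fset0Pn; exists x.
Qed.

Lemma sumset_fset X Y : sumset [set` X]%classic [set` Y]%classic = [set` X :+: Y]%classic.
Proof.
apply/seteqP; split=> x /=; first by case=> a aX [b bY <-]; exact: mem_addfs.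
by case/addfsP=> a aX [b bY ->]; exists a => //; exists b.
Qed.

Lemma ecard_setT_fset F : (forall x, x \in F) -> ecard [set: G]%classic = (#|` F|%:Z)%:E%E.
Proof.
move=> fF; rewrite -ecard_fset; congr ecard.
by apply/seteqP; split=> // x _ /=; exact: fF.
Qed.

(** For infinite [G] both sides hold: the bound is +oo, and a finite set misses a point. *)
Lemma ecard_proper X : (ecard [set` X]%classic <= ecard [set: G]%classic - 1)%E <->
  exists z, z \notin X.
Proof.
have [fG|iG] := pselect (finite_set [set: G]%classic); last first.
  have -> : ecard [set: G]%classic = +oo%E by rewrite /ecard asboolF.
  split=> [_|_]; last by rewrite leey.
  apply: contrapT => nX; apply: iG; apply: sub_finite_set (finite_fset X) => x _ /=.
  by apply: contrapT => /negP xX; apply: nX; exists x.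
have [F eF] := set_of_fset fG.
have fF x : x \in F by have : [set` F]%classic x by rewrite -eF.
rewrite (ecard_setT_fset fF) ecard_fset.
have XF : X `<=` F by apply/fsubsetP=> x _.
rewrite lee_fin; split=> [le|[z zX]].
  have ltXF : #|` X| < #|` F| by lia.
  have /fset0Pn[z] : F `\` X != fset0 by rewrite -cardfs_gt0 cardfsDS //; card_lia.
  by rewrite in_fsetD => /andP[zX _]; exists z.
have : X `<` F by rewrite fproperE XF /=; apply/fsubsetPn; exists z.
by move/fproper_ltn_card; lia.
Qed.

Lemma fset_zmodClosed K : fgroup K -> exists K' : zmodClosed G, [set` K']%classic = [set` K]%classic.
Proof.
move=> gK; have gK' : zmod_closed (mem K) := gK.
pose m := GRing.isZmodClosed.Build G (mem K) gK'.
pose K' : zmodClosed G := HB.pack (mem K : {pred G}) m.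
by exists K'.
Qed.

End ClassicalSets.

Section Kappa.
Variables (G : zmodType) (S : {fset G}).
Hypothesis S0 : S != fset0.

Lemma kappa1_range_fset X : X != fset0 -> (exists z, z \notin X :+: S) ->
  kappa1_range [set` S]%classic ((#|` X :+: S|%:Z - #|` X|%:Z)%R)%:E%E.
Proof.
move=> X0 pX; exists [set` X]%classic; last by rewrite sumset_fset !ecard_fset.
split; first exact: finite_fset.
  by apply/ecard_gt0P; case/fset0Pn: X0 => x; exists x.
by rewrite sumset_fset; apply/ecard_proper.
Qed.

Lemma kappa1_rangeP k : kappa1_range [set` S]%classic k ->
  exists2 X, k = (#|` X :+: S|%:Z - #|` X|%:Z)%R%:E%E &
    X != fset0 /\ exists z, z \notin X :+: S.
Proof.
case=> _ [/set_of_fset[X ->]]; rewrite sumset_fset => /ecard_gt0P[x xX] /ecard_proper pX <-.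
by exists X; rewrite ?ecard_fset //; split=> //; apply/fset0Pn; exists x.
Qed.

Lemma kappa1_le X : X != fset0 -> (exists z, z \notin X :+: S) ->
  (kappa1 [set` S]%classic <= (#|` X :+: S|%:Z - #|` X|%:Z)%R%:E)%E.
Proof.
move=> X0 pX; rewrite /kappa1; set P := (X in xget _ X).
(* As S is nonempty, the differences |Y + S| - |Y| are natural numbers, so a minimum exists and
   [xget] does not return its default. *)
have Pex : exists k, P k.
  pose N n := `[< exists Y, [/\ Y != fset0, exists z, z \notin Y :+: S &
                            (#|` Y :+: S| = #|` Y| + n)%N] >].
  have Nex Y : Y != fset0 -> (exists z, z \notin Y :+: S) -> N (#|` Y :+: S| - #|` Y|).
    by move=> Y0 pY; apply/asboolP; exists Y; rewrite subnKC // leq_card_addfs.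
  have exN : exists n, N n by eexists; exact: (Nex X).
  case: (ex_minnP exN) => n /asboolP[Y [Y0 pY cY]] minn.
  exists ((#|` Y :+: S|%:Z - #|` Y|%:Z)%R%:E)%E; split.
    exact: kappa1_range_fset.
  move=> _ /kappa1_rangeP[Z -> [Z0 pZ]]; rewrite lee_fin.
  have := minn _ (Nex Z Z0 pZ); rewrite cY; have := leq_card_addfs Z S0; lia.
have [_] := xgetPex (ecard [set: G]%classic - 1)%E Pex.
by apply; exact: kappa1_range_fset.
Qed.

End Kappa.

Local Close Scope fset_scope.
Local Open Scope classical_set_scope.
Local Open Scope ring_scope.

(** * From finite sets back to classical sets *)

Lemma fprogression_arith (Q : zmodType) (d : Q) (X : {fset Q}) :
  fprogression d X -> arith_prog d [set` X].
Proof.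
case=> a [j Xj]; exists a, j; apply/seteqP; split=> x /=.
  by case/Xj=> i ij ->; exists i.
by case=> i ij <-; apply/Xj; exists i.
Qed.

Lemma quasi_periodic_fset (G Q : zmodType) (f : {additive G -> Q}) (H : zmodClosed G)
    (S : {fset G}) (i : Q) (x0 : G) :
  (forall x y, (f x == f y) = (x - y \in H)) -> f x0 = i ->
  (forall x k, x \in S -> f x != i -> k \in H -> x + k \in S) ->
  quasi_periodic H [set` S].
Proof.
move=> kerf <- SP; exists x0.
have outP x : x \in S -> ~ sumset [set x0] [set` H] x <-> f x != f x0.
  move=> xS; rewrite kerf; split=> [nx|/negP nx [_ -> [k kH ek]]].
    apply/negP=> xH; apply: nx; exists x0 => //; exists (x - x0) => //.
    by rewrite addrC subrK.
  by apply: nx; rewrite -ek addrC addKr.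
apply/seteqP; split=> x.
  case=> y [/= yS /(outP _ yS) fy] [k kH <-].
  have ykS : y + k \in S by exact: SP.
  split=> //; apply/outP => //; rewrite kerf.
  apply: contra fy => h1; rewrite kerf.
  have := rpredB h1 kH; congr (_ \in H).
  by rewrite addrAC addrK.
move=> xS; exists x => //; exists 0; rewrite ?addr0 //=; exact: rpred0.
Qed.

Theorem theorem5p1 (G : zmodType) (S T : set G) (H : zmodClosed G)
  (hG : (2%:E <= ecard [set: G])%E)
  (finS : finite_set S) (finT : finite_set T)
  (genS : generating S)
  (leST : (ecard S <= ecard T)%E)
  (apST : aperiodic (sumset S T))
  (S0 : S 0) (T0 : T 0)
  (* |S + T| <= (2|G| + 2) / 3, with denominators cleared *)
  (leG : (3%:E * ecard (sumset S T) <= 2%:E * ecard [set: G] + 2%:E)%E)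
  (eqST : ecard (sumset S T) = (ecard S + ecard T - 1)%E)
  (hypH : hyper_atom S H) :
  [/\ quasi_periodic H S, quasi_periodic H T
    & exists d : Quotient.quot H,
        arith_prog d (\pi_(Quotient.quot H)%qT @` S) /\
        arith_prog d (\pi_(Quotient.quot H)%qT @` T)].
Proof.
have [Sf eS] := set_of_fset finS; have [Tf eT] := set_of_fset finT.
case: hypH => -[finH _ dualH kapH] maxH.
have [K eK] := set_of_fset finH.
have KH x : (x \in K) = (x \in H).
  by apply/idP/idP => xK; [have : [set` H] x by rewrite eK|have : [set` K] x by rewrite -eK].
have gK : fgroup K.
  by split=> [|x y]; rewrite !KH; [exact: rpred0 | exact: rpredB].
pose f : {additive G -> Quotient.quot H} := (\pi_(Quotient.quot H)%qT).
have kerf x y : (f x == f y) = (x - y \in K).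
  by rewrite KH Quotient.idealrBE.
have surjf q : exists x, f x = q by exists (repr q); exact: reprK.
have fS (X : {fset G}) : f @` [set` X] = [set` [fset f x | x in X]%fset].
  apply/seteqP; split=> q /=; first by case=> x xX <-; exact: mem_fimage.
  by case/imfsetP=> x /= xX ->; exists x.
subst S T; rewrite !sumset_fset !ecard_fset in leST leG eqST apST.
rewrite /sdual eK sumset_fset in dualH kapH.
have Sf0 : 0 \in Sf by [].
have Sn0 : Sf != fset0 by apply/fset0Pn; exists 0.
have [z1 z1KS] : exists z, z \notin (K :+: Sf)%fset.
  by have /ecard_gt0P[z /= zKS] := dualH; exists z; apply/negP.
rewrite eK !ecard_fset in kapH maxH.
have kap (X : {fset G}) : X != fset0 -> (exists z, z \notin (X :+: Sf)%fset) ->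
    (#|` X| + #|` (Sf :+: K)%fset| <= #|` (X :+: Sf)%fset| + #|` K|)%N.
  move=> X0 pX; have := kappa1_le Sn0 X0 pX; rewrite -kapH lee_fin [(Sf :+: K)%fset]addfsC.
  have := leq_card_addfs X Sn0; have := leq_card_addfs K Sn0; lia.
(* Equality would make L a 1-fragment larger than the hyper-atom. *)
have mx (L : {fset G}) : fgroup L -> (#|` K| < #|` L|)%N -> (exists z, z \notin (L :+: Sf)%fset) ->
    (#|` L| + #|` (Sf :+: K)%fset| < #|` (L :+: Sf)%fset| + #|` K|)%N.
  move=> gL ltKL pL; rewrite ltnNge; apply/negP=> le.
  have ge := kap _ (fgroup_neq0 gL) pL.
  have [L' eL'] := fset_zmodClosed gL.
  have := maxH L'; rewrite eL' !ecard_fset lee_fin lez_nat leqNgt ltKL => /(_ _)/negP.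
  apply=> //; split.
  - exact: finite_fset.
  - by apply/ecard_gt0P; exists 0; case: gL.
  - by case: pL => z zL; apply/ecard_gt0P; exists z; rewrite /sdual sumset_fset; apply/negP.
  - rewrite sumset_fset !ecard_fset -kapH; congr (_%:E).
    by move: le ge; rewrite [(Sf :+: K)%fset]addfsC; lia.
(* Otherwise S lies in H since 0 is in S, and as S generates G, H would be G; but z1 is outside H +
   S. *)
have A1 : (1 < #|` [fset f x | x in Sf]%fset|)%N.
  rewrite ltnNge; apply/negP=> le1; move: z1KS => /negP; apply.
  have SH : [set` Sf] `<=` [set` H].
    move=> x /= xS; rewrite -KH -[x]subr0 -kerf; apply: contrapT => /negP ne.
    move: le1; rewrite leqNgt => /negP; apply; apply/cardfs_gt1P.
    by exists (f x), (f 0); split=> //; apply: mem_fimage.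
  rewrite -[z1]addr0 mem_addfs // KH.
  have : [set: G] z1 by [].
  rewrite -genS => /(_ [set` H]); apply; split=> //.
  by exists H.
have stab1 : (stab (Sf :+: Tf)%fset `<=` [fset 0])%fset.
  apply/fsubsetP=> x; rewrite mem_stab; last first.
    by rewrite addfs_neq0 Sn0; apply/fset0Pn; exists 0.
  move=> /eqP ex; have : period [set` (Sf :+: Tf)%fset] x.
    rewrite /period /=; have -> : [set x] = [set` [fset x]%fset].
      by apply/seteqP; split=> y /=; rewrite ?inE => /eqP // ; rewrite ?inE.
    by rewrite sumset_fset ex.
  by rewrite apST => ->; rewrite inE.
(* If S + T were G, every element of G would be a period of it, so G would be trivial, whereas S has
   two images in the quotient. *)
have [z0 z0ST] : exists z, z \notin (Sf :+: Tf)%fset.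
  apply: contrapT => full.
  have [_ [_ [/imfsetP[x /= xS ->] /imfsetP[y /= yS ->] xy]]] := cardfs_gt1P _ A1.
  have zero (u : G) : u = 0.
    have : u \in stab (Sf :+: Tf)%fset.
      rewrite mem_stab; last by rewrite addfs_neq0 Sn0; apply/fset0Pn; exists 0.
      by apply/eqP/addfs_stable/fsubsetP=> v _; apply: contrapT => /negP nv; apply: full; exists v.
    by move/(fsubsetP stab1); rewrite inE => /eqP.
  by move: xy; rewrite (zero x) (zero y) eqxx.
have cST : (#|` (Sf :+: Tf)%fset| + 1 = #|` Sf| + #|` Tf|)%N.
  have e : (#|` (Sf :+: Tf)%fset|%:Z)%:E = (#|` Sf|%:Z + #|` Tf|%:Z - 1)%:E :> \bar int := eqST.
  by move: (EFin_inj e); clear; lia.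
have lST : (#|` Sf| <= #|` Tf|)%N by move: leST; rewrite lee_fin.
have two (F : {fset G}) : (forall x, x \in F) -> (3 * #|` (Sf :+: Tf)%fset| <= 2 * #|` F| + 2)%N.
  move=> fF; move: leG; rewrite (ecard_setT_fset fF) -!EFinM -EFinD lee_fin; lia.
have cstab : (#|` stab (Sf :+: Tf)%fset| <= 1)%N.
  by rewrite -(cardfs1 (0 : G)) fsubset_leq_card.
have [i0 [j0 [SP TP]]] := quotient_quasi_periodic gK kerf surjf Sf0 z0ST cST lST two kap mx A1 cstab.
have [d [dS dT]] := quotient_progressions gK kerf surjf Sf0 z0ST cST lST two kap mx A1.
have kerfH x y : (f x == f y) = (x - y \in H) by rewrite kerf KH.
split.
- have [x0 ex0] := surjf i0; apply: (quasi_periodic_fset kerfH ex0) => x k xS fx kH.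
  by apply: SP; rewrite ?KH.
- have [x0 ex0] := surjf j0; apply: (quasi_periodic_fset kerfH ex0) => x k xS fx kH.
  by apply: TP; rewrite ?KH.
- by exists d; rewrite !fS; split; exact: fprogression_arith.
Qed.
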